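(* Let $(R,\mathfrak{m})$ be a Noetherian local ring of dimension $d$ and prime characteristic $p$. Let $Q(R)$ be the total quotient ring of $R$, and let $(S,\mathfrak{n})$ be a Cohen-Macaulay local ring of dimension $d$ such that $R\subseteq S\subseteq Q(R)$ and $S$ is a finite $R$-module. Let $Q$ be an ideal of $R$ generated by a system of parameters. Suppose that for some fixed integer $n\ge 0$, $$\ell(R/(Q^{n+1})^* )=e_0(Q)\binom{n+d}{d}.$$ Then $R=S$. In particular, $R$ is F-rational.
   Context: All rings are commutative and Noetherian with identity. $\ell(M)$ denotes the length of an $R$-module $M$, and $e_0(Q)$ denotes the (Hilbert–Samuel) multiplicity of the $\mathfrak{m}$-primary ideal $Q$. For $R$ of prime characteristic $p$, let $R^\circ$ be the set of elements of $R$ not in any minimal prime of $R$. For an ideal $I=(x_1,\dots,x_n)$ let $I^{[p^e]}=(x_1^{p^e},\dots,x_n^{p^e})$. The tight closure $I^*$ of $I$ is the set of all $x\in R$ for which there exists $c\in R^\circ$ with $cx^{p^e}\in I^{[p^e]}$ for all sufficiently large $p^e$. A parameter ideal of height $n$ is an ideal of height $n$ generated by $n$ elements. $R$ is F-rational if every parameter ideal $I$ is tightly closed, i.e. $I=I^*$. *)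

(* Defs.v *)
From HB Require Import structures.
From mathcomp Require Import all_boot all_order all_algebra.
From mathcomp Require Import boolp classical_sets.

Set Implicit Arguments.
Unset Strict Implicit.
Unset Printing Implicit Defensive.

Import GRing.Theory.
Local Open Scope classical_set_scope.
Local Open Scope ring_scope.

Definition is_maximum (A : set nat) (n : nat) : Prop :=
  A n /\ forall k : nat, A k -> (k <= n)%N.

Section Ideals.
Variable R : comNzRingType.
Implicit Types (I J P m : set R) (s : seq R).

Definition is_ideal I : Prop :=
  [/\ I 0, forall x y, I x -> I y -> I (x + y) & forall a x, I x -> I (a * x)].

Definition ideal_gen (A : set R) : set R := smallest is_ideal A.

(* The ideal (x_1, ..., x_n). *)
Definition ideal_seq s : set R := ideal_gen [set` s].

Definition ideal_mul I J : set R :=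
  ideal_gen [set z | exists x y, [/\ I x, J y & z = x * y]].

Definition ideal_pow I (n : nat) : set R := iter n (ideal_mul I) [set: R].

Definition radical I : set R := [set x | exists k : nat, I (x ^+ k)].

Definition noetherian : Prop :=
  forall I, is_ideal I -> exists s, I = ideal_seq s.

Definition is_prime_ideal P : Prop :=
  [/\ is_ideal P, ~ P 1 & forall x y, P (x * y) -> P x \/ P y].

Definition is_maximal_ideal m : Prop :=
  [/\ is_ideal m, ~ m 1 & forall J, is_ideal J -> m `<=` J -> ~ J 1 -> J = m].

Definition is_local_ring m : Prop :=
  is_maximal_ideal m /\ forall m', is_maximal_ideal m' -> m' = m.

Definition is_minimal_prime P : Prop :=
  is_prime_ideal P /\ forall P', is_prime_ideal P' -> P' `<=` P -> P' = P.

(* C 0 < C 1 < ... < C n, a strict chain of length n (n + 1 members) of sets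
   satisfying T; the values of C beyond n are irrelevant. *)
Definition strict_chain (T : set R -> Prop) (n : nat) (C : nat -> set R) :=
  (forall i, (i <= n)%N -> T (C i)) /\
  (forall i, (i < n)%N -> C i `<` C i.+1).

Definition krull_dim (d : nat) : Prop :=
  is_maximum [set n | exists C, strict_chain is_prime_ideal n C] d.

Definition prime_height P (h : nat) : Prop :=
  is_maximum
    [set n | exists2 C, strict_chain is_prime_ideal n C & C n = P] h.

(* The unit ideal has no height in this sense (its height is infinite). *)
Definition ideal_height I (h : nat) : Prop :=
  (exists P, [/\ is_prime_ideal P, I `<=` P & prime_height P h]) /\
  (forall P k, is_prime_ideal P -> I `<=` P -> prime_height P k -> (h <= k)%N).

(* "l(R/J) is finite and equal to l", for an ideal J: the submodules of the
   R-module R/J are the I/J with I an ideal of R containing J. *)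
Definition quotient_length J (l : nat) : Prop :=
  is_maximum
    [set n | exists C, strict_chain (fun I => is_ideal I /\ J `<=` I) n C] l.

(* e = e_0(Q) for Q primary to the maximal ideal of a Noetherian local ring of
   dimension d: l(R/Q^{n+1}) agrees for n >> 0 with a polynomial of degree d
   in n, whose leading coefficient is e_0(Q) / d!. *)
Definition multiplicity (d : nat) (Q : set R) (e : nat) : Prop :=
  exists f : {poly rat},
    [/\ exists N : nat, forall n : nat, (N <= n)%N ->
          exists2 l : nat, quotient_length (ideal_pow Q n.+1) l
                         & f.[n%:R] = l%:R,
        size f = d.+1
      & e%:R = (d`!)%:R * lead_coef f].

(* s is a system of parameters of the local ring (R, m) of dimension d. *)
Definition system_of_parameters m (d : nat) s : Prop :=
  size s = d /\ radical (ideal_seq s) = m.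

Definition regular_sequence s : Prop :=
  ~ ideal_seq s 1 /\
  forall i, (i < size s)%N ->
    forall y, ideal_seq (take i s) (s`_i * y) -> ideal_seq (take i s) y.

Definition depth m (k : nat) : Prop :=
  is_maximum
    [set n | exists s, [/\ size s = n, [set` s] `<=` m & regular_sequence s]] k.

Definition cohen_macaulay_local m : Prop :=
  [/\ noetherian, is_local_ring m & exists2 d, krull_dim d & depth m d].

(* The complement of the union of the minimal primes. *)
Definition ring_circ : set R :=
  [set c | forall P, is_minimal_prime P -> ~ P c].

(* I^{[q]}: for q a power of the prime characteristic, the ideal generated by
   the x_i^q does not depend on the finite generating family (x_i) of I. *)
Definition frobenius_power I (q : nat) : set R :=
  [set y | exists2 s, I = ideal_seq s & ideal_seq [seq x ^+ q | x <- s] y].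

Definition tight_closure (p : nat) I : set R :=
  [set x | exists2 c, ring_circ c &
     exists N : nat, forall e : nat, (N <= e)%N ->
       frobenius_power I (p ^ e) (c * x ^+ (p ^ e))].

Definition parameter_ideal (n : nat) I : Prop :=
  ideal_height I n /\ exists2 s, size s = n & I = ideal_seq s.

Definition F_rational (p : nat) : Prop :=
  forall n I, parameter_ideal n I -> I = tight_closure p I.

Definition nonzerodivisor (b : R) : Prop := forall x, b * x = 0 -> x = 0.

End Ideals.

Arguments noetherian : clear implicits.
Arguments krull_dim : clear implicits.
Arguments F_rational : clear implicits.

(* (K, iota) is the localization of R at its nonzerodivisors; iota is then
   injective, and K is unique up to a unique isomorphism over R. *)
Definition is_total_quotient_ring (R K : comNzRingType)
    (iota : {rmorphism R -> K}) : Prop :=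
  [/\ injective iota,
      forall b, nonzerodivisor b -> exists u, iota b * u = 1
    & forall z, exists a b, nonzerodivisor b /\ z * iota b = iota a].

Definition module_finite (R S : comNzRingType) (i : {rmorphism R -> S}) : Prop :=
  exists g : seq S, forall y : S,
    exists a : nat -> R, y = \sum_(k < size g) i (a k) * g`_k.

(* Main.v *)
Require Import Defs.
From mathcomp Require Import all_boot all_order all_algebra.
From mathcomp Require Import boolp classical_sets.
From mathcomp Require Import ring lra.

Set Implicit Arguments.
Unset Strict Implicit.
Unset Printing Implicit Defensive.

Import Order.TTheory GRing.Theory Num.Theory.
Local Open Scope classical_set_scope.
Local Open Scope ring_scope.

(** Every length below is a length over R, and l denotes length. Let s be the
given system of parameters, Q = (s), and l0 = l(S/QS).

As S is Cohen-Macaulay, s is a regular sequence in S, so the length of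
S/Q^{k+1}S is l0 * C(k+d, d) for every k ([colength_power_mod]). A common
denominator c of the finitely many generators of S is a nonzerodivisor of R with
cS inside R ([common_denominator]), and it is used twice.

- Since c cuts the dimension down by one, l(S/(R + Q^{k+1}S)) is bounded by a
  polynomial in k of degree less than d ([cokernel_bound]). The leading terms of
  l(S/Q^{k+1}S) <= l(R/Q^{k+1}) + l(S/(R + Q^{k+1}S)) then give l0 <= e_0(Q)
  ([leading_term_le]).

- If z in R lies in KS for an ideal K of R, then c z^q lies in K^{[q]} for every
  q = p^e, so z is in K^* ([extension_tight_closure]). Hence Q^{n+1}S meets R
  inside (Q^{n+1})^*.

By hypothesis e_0(Q) C(n+d, d) is the colength of (Q^{n+1})^* in R. Hence it is
at most the colength of R meet Q^{n+1}S, which is l(S/Q^{n+1}S) - l(S/(R +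
Q^{n+1}S)) and so is at most e_0(Q) C(n+d, d) - l(S/(R + Q^{n+1}S)). So S = R +
Q^{n+1}S, and S = R by Nakayama; moreover (Q^{n+1})^* = Q^{n+1}.

Now R is Cohen-Macaulay. If u is in Q^* and x is the first element of s, then
x^n u is in (Q^{n+1})^* = Q^{n+1}, so u is in Q because s is a regular sequence
([power_mod_colonX]): Q is tightly closed. Tight closedness passes to every
system of parameters ([tclosed_params]), and then to every parameter ideal,
which is the intersection of ideals (xs, zs^t) with xs, zs a system of
parameters ([tclosed_partial]).

Both regularity in S and tight closedness in R spread from one system of
parameters to all of them by the same device, [params_connected]: any two
systems of parameters are joined by a path that replaces one element at a time.
Its only geometric input is Krull's principal ideal theorem ([krull_principal]).
*)

(** * Chains of sets and lengths of modules *)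

Section Chains.
Variable A : comNzRingType.
Implicit Types (T : set A -> Prop) (X Y : set A).

(** A recursive form of [strict_chain]: there is a strict chain of n sets
satisfying T above X, where X itself need not satisfy T. Lengths and Krull
dimensions are both maxima of such chains, with submodules or primes for T. *)
Fixpoint ascends T X n : Prop :=
  if n is n'.+1 then exists Y, [/\ T Y, X `<` Y & ascends T Y n'] else True.

Lemma ascends_below T X Y n : X `<=` Y -> ascends T Y n -> ascends T X n.
Proof.
case: n => [//|n] sXY [Z [TZ [sYZ nsZY] chZ]]; exists Z; split=> //; split.
  exact: subset_trans sYZ.
by move=> sZX; apply: nsZY; exact: subset_trans sXY.
Qed.

Lemma ascends_impl T T' X n : (forall Y, T Y -> T' Y) ->
  ascends T X n -> ascends T' X n.
Proof.
move=> TT'; elim: n X => [//|n IH] X [Y [TY sXY chY]].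
by exists Y; split; [exact: TT' | | exact: IH].
Qed.

Lemma ascends_above T N X n : N `<=` X ->
  ascends T X n -> ascends (fun Y => T Y /\ N `<=` Y) X n.
Proof.
elim: n X => [//|n IH] X sNX [Y [TY sXY chY]].
have sNY : N `<=` Y by apply: (subset_trans sNX); case: sXY.
by exists Y; split=> //; exact: IH.
Qed.

Lemma strict_chain_ascends T n C k :
  strict_chain T n C -> ascends T (C n) k -> ascends T (C 0%N) (n + k)%N.
Proof.
elim: n C k => [//|n IH] C k [TC ltC] chC.
have [T1 lt1] : strict_chain T n (fun j => C j.+1).
  by split=> j ltjn; [apply: TC | apply: ltC].
exists (C 1%N); split; [exact: TC | exact: ltC |].
exact: (IH (fun j => C j.+1)).
Qed.

Lemma ascends_strict_chain T X n : T X -> ascends T X n ->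
  exists2 C, strict_chain T n C & C 0%N = X.
Proof.
elim: n X => [|n IH] X TX; first by move=> _; exists (fun=> X).
move=> [Y [TY ltXY /(IH _ TY)[C [TC ltC] C0]]].
exists (fun j => if j is j'.+1 then C j' else X) => //; split=> -[|j] //= ltjn.
- exact: TC.
- by rewrite C0.
- exact: ltC.
Qed.

Lemma bounded_maximum (E : set nat) k : E 0%N ->
  (forall n, E n -> (n <= k)%N) -> exists l, is_maximum E l.
Proof.
move=> E0 bE.
have exE : exists n, `[< E n >] by exists 0%N; apply/asboolP.
have bE' n : `[< E n >] -> (n <= k)%N by move/asboolP; exact: bE.
case: (ex_maxnP exE bE') => l /asboolP El maxl; exists l; split=> // n En.
by apply: maxl; apply/asboolP.
Qed.

End Chains.

Lemma is_maximum_uniq E k l : is_maximum E k -> is_maximum E l -> k = l.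
Proof.
move=> [Ek maxk] [El maxl]; apply/eqP; rewrite eqn_leq.
by rewrite maxl // maxk.
Qed.

Section Submodules.
Variables (R S : comNzRingType) (i : {rmorphism R -> S}).
Implicit Types (N M : set S).

(** The R-submodules of S. Ideals of R are the case i = idfun, so a single
notion of length covers both R/J and S/N. *)
Definition is_sub N : Prop :=
  [/\ N 0, forall x y, N x -> N y -> N (x + y)
    & forall a x, N x -> N (i a * x)].

Lemma sub0 N : is_sub N -> N 0. Proof. by case. Qed.
Lemma subD N x y : is_sub N -> N x -> N y -> N (x + y).
Proof. by case=> _ + _; apply. Qed.
Lemma subZ N a x : is_sub N -> N x -> N (i a * x).
Proof. by case=> _ _; apply. Qed.
Lemma subN N x : is_sub N -> N x -> N (- x).
Proof. by move=> sN Nx; rewrite -mulN1r -(rmorphN1 i); exact: subZ. Qed.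
Lemma subB N x y : is_sub N -> N x -> N y -> N (x - y).
Proof. by move=> sN Nx Ny; apply: subD => //; exact: subN. Qed.
Lemma sub_sum N n (F : 'I_n -> S) : is_sub N -> (forall k, N (F k)) ->
  N (\sum_k F k).
Proof.
by move=> sN NF; apply: (big_ind N) => //; [exact: sub0 | move=> *;
  exact: subD].
Qed.
Lemma sub_setT : is_sub setT. Proof. by []. Qed.

Lemma ideal_sub N : is_ideal N -> is_sub N.
Proof. by case=> N0 ND NZ; split=> // a x; exact: NZ. Qed.

Definition colength_le N l := forall n, ascends is_sub N n -> (n <= l)%N.

(** The length of the R-module S/N. *)
Definition colength N l := is_maximum (ascends is_sub N) l.

Lemma colength_le_sub N M l : N `<=` M -> colength_le N l -> colength_le M l.
Proof. by move=> sNM bN n chM; apply: bN; exact: ascends_below chM. Qed.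

Lemma colength_le_full : colength_le setT 0.
Proof. by move=> [//|n] [Y [_ [_ nY] _]]; case: nY. Qed.

Lemma colength_full : colength setT 0.
Proof. by split=> //; exact: colength_le_full. Qed.

Lemma colength0_full N : colength_le N 0 -> N = setT.
Proof.
move=> bN; apply/seteqP; split=> // x _; apply: contrapT => nNx.
suff: (1 <= 0)%N by [].
by apply: bN; exists setT; split=> //; split=> // sTN; apply: nNx; exact: sTN.
Qed.

Lemma colength_exists N l : colength_le N l ->
  exists2 k, colength N k & (k <= l)%N.
Proof.
move=> bN; have [k lenk] := bounded_maximum (E := ascends is_sub N) I bN.
by exists k => //; apply: bN; case: lenk.
Qed.

(** The descending chain condition in S/N: n strict steps of D, read upwards,
form a chain of length n above N. *)
Lemma colength_le_stable N l (D : nat -> set S) : colength_le N l ->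
  (forall n, is_sub (D n)) -> (forall n, N `<=` D n) ->
  (forall n, D n.+1 `<=` D n) -> exists n, D n `<=` D n.+1.
Proof.
move=> bN sD sND decD; apply: contrapT => nst.
have chD n : ascends is_sub (D n) n.
  elim: n => [//|n IH]; exists (D n); split=> //; split=> // sD1.
  by apply: nst; exists n.
by have := bN l.+1 (ascends_below (sND _) (chD _)); rewrite ltnn.
Qed.

End Submodules.

Lemma quotient_length_bound (R : comNzRingType) (J : set R) l : is_ideal J ->
  quotient_length J l -> colength_le idfun J l.
Proof.
move=> iJ [_ maxl] n chJ; apply: maxl.
have chJ' : ascends (fun I => is_ideal I /\ J `<=` I) J n.
  by apply: ascends_above => //; exact: ascends_impl chJ.
by have [|C chC _] := ascends_strict_chain _ chJ'; [split | exists C].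
Qed.

Lemma quotient_length_chain (R : comNzRingType) (J : set R) l :
  quotient_length J l ->
  exists J', [/\ is_ideal J', J `<=` J' & ascends (is_sub idfun) J' l].
Proof.
move=> [[C chC] _]; exists (C 0%N); have [iC JC] := chC.1 0%N (leq0n _).
split=> //; have := strict_chain_ascends (k := 0) chC I; rewrite addn0.
by apply: ascends_impl => Y [iY _]; exact: ideal_sub.
Qed.

Section Additivity.
Variables (R V W : comNzRingType).
Variables (i : {rmorphism R -> V}) (k : {rmorphism R -> W}) (f : V -> W).
Hypothesis fD : forall x y, f (x + y) = f x + f y.
Hypothesis fZ : forall a x, f (i a * x) = k a * f x.
Implicit Types (N : set W) (M : set V).

(** The submodule N + f(M). *)
Definition sum_image N M : set W := [set w | exists2 v, M v & N (w - f v)].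

Let f0 : f 0 = 0.
Proof. by have := fZ 0 0; rewrite !rmorph0 !mul0r. Qed.
Let fN x : f (- x) = - f x.
Proof. by apply/eqP; rewrite -subr_eq0 opprK -fD addNr f0. Qed.

Lemma sub_preimage N : is_sub k N -> is_sub i (f @^-1` N).
Proof.
move=> sN; split=> [|x y Nx Ny|a x Nx] /=.
- by rewrite f0; exact: sub0 sN.
- by rewrite fD; exact: (subD sN).
- by rewrite fZ; exact: (subZ _ sN).
Qed.

Lemma sub_sum_image N M : is_sub k N -> is_sub i M -> is_sub k (sum_image N M).
Proof.
move=> sN sM; split=> [|x y [u Mu Nu] [v Mv Nv]|a x [u Mu Nu]].
- by exists 0; [exact: sub0 sM | rewrite f0 subr0; exact: sub0 sN].
- exists (u + v); first exact: (subD sM).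
  by rewrite fD opprD addrACA; exact: (subD sN).
- exists (i a * u); first exact: (subZ _ sM).
  by rewrite fZ -mulrBr; exact: (subZ _ sN).
Qed.

Lemma sum_image_subl N M : is_sub i M -> N `<=` sum_image N M.
Proof. by move=> sM x Nx; exists 0; [exact: sub0 sM | rewrite f0 subr0]. Qed.

(** At each step X < Y of a chain above N, the preimage or the sum with the
image of f must grow strictly, since an x in Y is determined modulo f(V) by the
sum and then by the preimage. This is the modular law behind Jordan-Hoelder. *)
Lemma ascends_split N n : is_sub k N -> ascends (is_sub k) N n ->
  exists a b, [/\ (n <= a + b)%N, ascends (is_sub i) (f @^-1` N) a
                & ascends (is_sub k) (sum_image N setT) b].
Proof.
elim: n N => [|n IH] N sN; first by exists 0%N, 0%N.
move=> [L [sL [sNL nLN] /(IH _ sL)[a [b [leab cha chb]]]]].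
have sp : f @^-1` N `<=` f @^-1` L by move=> x; exact: sNL.
have si : sum_image N setT `<=` sum_image L setT.
  by move=> w [v _ Nw]; exists v => //; exact: sNL.
have [pLN|npLN] := pselect (f @^-1` L `<=` f @^-1` N); last first.
  exists a.+1, b; split; rewrite ?addSn ?ltnS //.
    by exists (f @^-1` L); split=> //; exact: sub_preimage.
  exact: ascends_below chb.
exists a, b.+1; split; rewrite ?addnS ?ltnS //; first exact: ascends_below cha.
exists (sum_image L setT); split=> //; first exact: sub_sum_image.
split=> // siLN; apply: nLN => x Lx.
have [v _ Nv] := siLN x (sum_image_subl (@sub_setT _ _ i) Lx).
have Lv : L (f v) by rewrite -[f v](subKr x); apply: (subB sL) => //;
  exact: sNL.
by rewrite -(subrK (f v) x); apply: (subD sN) => //; exact: pLN.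
Qed.

(** A chain M of submodules above the preimage of N becomes the chain N + f(M),
still strict because M contains the preimage of N. *)
Lemma ascends_join N a b : is_sub k N -> ascends (is_sub i) (f @^-1` N) a ->
  ascends (is_sub k) (sum_image N setT) b -> ascends (is_sub k) N (a + b)%N.
Proof.
elim: a N => [|a IH] N sN.
  by move=> _; apply: ascends_below; exact: sum_image_subl.
move=> [M [sM [sNM nMN] chM]] chb; rewrite addSn.
exists (sum_image N M); split; first exact: sub_sum_image.
- split; first exact: sum_image_subl.
  move=> sN'; apply: nMN => x Mx /=; apply: sN'; exists x => //.
  by rewrite subrr; exact: sub0 sN.
- apply: IH; first exact: sub_sum_image.
    apply: ascends_below chM => x [v Mv Nv].
    rewrite -(subrK v x); apply: (subD sM) => //.
    by apply: sNM; rewrite /= fD fN.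
  apply: ascends_below chb => w [v _ [u Mu Nu]].
  by exists (v + u) => //; rewrite fD opprD addrA.
Qed.

Lemma colength_le_add N a b : is_sub k N -> colength_le i (f @^-1` N) a ->
  colength_le k (sum_image N setT) b -> colength_le k N (a + b).
Proof.
move=> sN ba bb n /(ascends_split sN)[u [v [le_n chu chv]]].
by apply: (leq_trans le_n); apply: leq_add; [exact: ba | exact: bb].
Qed.

(** The exact sequence 0 -> V/f^{-1}(N) -> W/N -> W/(N + f(V)) -> 0. All length
computations are instances, with f the inclusion of R in S, the map r |-> r g,
or multiplication by an element of S. *)
Lemma colength_add N a b : is_sub k N -> colength i (f @^-1` N) a ->
  colength k (sum_image N setT) b -> colength k N (a + b).
Proof.
move=> sN [cha ba] [chb bb]; split; first exact: ascends_join.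
exact: colength_le_add.
Qed.

End Additivity.

(** * Ideals *)

Section Ideals.
Variable A : comNzRingType.
Implicit Types (I J P Q : set A) (xs ys : seq A).

Lemma ideal0 I : is_ideal I -> I 0. Proof. by case. Qed.
Lemma idealD I x y : is_ideal I -> I x -> I y -> I (x + y).
Proof. by case=> _ + _; apply. Qed.
Lemma idealM I a x : is_ideal I -> I x -> I (a * x).
Proof. by case=> _ _; apply. Qed.
Lemma idealMl I a x : is_ideal I -> I x -> I (x * a).
Proof. by rewrite mulrC; exact: idealM. Qed.
Lemma idealN I x : is_ideal I -> I x -> I (- x).
Proof. by move=> iI Ix; rewrite -mulN1r; exact: idealM. Qed.
Lemma idealB I x y : is_ideal I -> I x -> I y -> I (x - y).
Proof. by move=> iI Ix Iy; apply: idealD => //; exact: idealN. Qed.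
Lemma ideal_sum I n (F : 'I_n -> A) : is_ideal I -> (forall k, I (F k)) ->
  I (\sum_k F k).
Proof.
by move=> iI IF; apply: (big_ind I) => //; [exact: ideal0 | move=> *;
  exact: idealD].
Qed.
Lemma idealDl I x y : is_ideal I -> I y -> I (x + y) -> I x.
Proof. by move=> iI Iy Ixy; rewrite -(addrK y x); exact: idealB. Qed.
Lemma ideal_congr I x y : is_ideal I -> I (x - y) -> I y -> I x.
Proof. by move=> iI Ixy Iy; rewrite -(subrK y x); exact: idealD. Qed.
Lemma ideal1 I : is_ideal I -> I 1 -> I = setT.
Proof.
by move=> iI I1; apply/seteqP; split=> // x _; rewrite -[x]mulr1; exact: idealM.
Qed.
Lemma ideal_full : is_ideal (@setT A). Proof. by []. Qed.
Lemma ideal_zero : is_ideal [set 0 : A].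
Proof. by split=> //= [x y -> ->|a x ->]; rewrite ?addr0 ?mulr0. Qed.

Lemma ideal_gen_ideal (X : set A) : is_ideal (ideal_gen X).
Proof.
split=> [J [iJ _]|x y Xx Xy J JX|a x Xx J JX]; first exact: ideal0.
- by apply: idealD; [case: JX | exact: Xx | exact: Xy].
- by apply: idealM; [case: JX | exact: Xx].
Qed.
Lemma ideal_gen_sub (X : set A) J : is_ideal J -> X `<=` J ->
  ideal_gen X `<=` J.
Proof. by move=> iJ XJ x; apply. Qed.
Lemma ideal_gen_mem (X : set A) : X `<=` ideal_gen X.
Proof. by move=> x Xx J [_]; apply. Qed.

Lemma ideal_seq_ideal xs : is_ideal (ideal_seq xs).
Proof. exact: ideal_gen_ideal. Qed.
Lemma ideal_seq_mem xs x : x \in xs -> ideal_seq xs x.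
Proof. by move=> xs_x; exact: ideal_gen_mem. Qed.
Lemma ideal_seq_sub xs J : is_ideal J -> (forall x, x \in xs -> J x) ->
  ideal_seq xs `<=` J.
Proof. by move=> iJ xsJ; exact: ideal_gen_sub. Qed.

(** The ideal I + (x). *)
Definition adjoin I x : set A := [set y | exists a, I (y - a * x)].

(** The ideal I + (xs), folded from the left so that it can be followed while a
sequence is consumed from its head. *)
Definition adjoins I xs : set A := foldl adjoin I xs.

Lemma adjoin_ideal I x : is_ideal I -> is_ideal (adjoin I x).
Proof.
move=> iI; split=> [|y z [a Iy] [b Iz]|c y [a Iy]].
- by exists 0; rewrite mul0r subr0; exact: ideal0.
- by exists (a + b); rewrite mulrDl opprD addrACA; exact: idealD.
- by exists (c * a); rewrite -mulrA -mulrBr; exact: idealM.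
Qed.
Lemma adjoin_subl I x : I `<=` adjoin I x.
Proof. by move=> y Iy; exists 0; rewrite mul0r subr0. Qed.
Lemma adjoin_mem I x : is_ideal I -> adjoin I x x.
Proof. by move=> iI; exists 1; rewrite mul1r subrr; exact: ideal0. Qed.
Lemma adjoin_sub I J x : is_ideal J -> I `<=` J -> J x -> adjoin I x `<=` J.
Proof.
move=> iJ IJ Jx y [a Iy]; apply: (ideal_congr iJ (IJ _ Iy)); exact: idealM.
Qed.
Lemma adjoin_proper I x : is_ideal I -> ~ I x -> I `<` adjoin I x.
Proof.
move=> iI nIx; split=> [|sI]; first exact: adjoin_subl.
by apply: nIx; apply: sI; exact: adjoin_mem.
Qed.

Lemma adjoins_ideal I xs : is_ideal I -> is_ideal (adjoins I xs).
Proof. by elim: xs I => [//|x xs IH] I iI; apply: IH; exact: adjoin_ideal. Qed.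
Lemma adjoins_subl I xs : I `<=` adjoins I xs.
Proof.
by elim: xs I => [|x xs IH] I //; apply: subset_trans (IH _);
  exact: adjoin_subl.
Qed.
Lemma adjoins_mem I xs x : is_ideal I -> x \in xs -> adjoins I xs x.
Proof.
elim: xs I => [//|y xs IH] I iI; rewrite inE => /predU1P[->|xs_x].
  by apply: (@adjoins_subl (adjoin I y)); exact: adjoin_mem.
by apply: IH => //; exact: adjoin_ideal.
Qed.
Lemma adjoins_sub I J xs : is_ideal J -> I `<=` J ->
  (forall x, x \in xs -> J x) -> adjoins I xs `<=` J.
Proof.
elim: xs I => [//|y xs IH] I iJ IJ Jxs; apply: IH => //; last first.
  by move=> x xs_x; apply: Jxs; rewrite inE xs_x orbT.
by apply: adjoin_sub => //; apply: Jxs; rewrite mem_head.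
Qed.
Lemma adjoins_sub2 I J xs ys : is_ideal J -> I `<=` J -> {subset xs <= ys} ->
  adjoins I xs `<=` adjoins J ys.
Proof.
move=> iJ IJ sxy; apply: adjoins_sub; first exact: adjoins_ideal.
  by apply: (subset_trans IJ); exact: adjoins_subl.
by move=> x /sxy; exact: adjoins_mem.
Qed.
Lemma adjoins_rcons I xs x : adjoins I (rcons xs x) = adjoin (adjoins I xs) x.
Proof. by rewrite /adjoins foldl_rcons. Qed.
Lemma adjoins_cat I xs ys : adjoins I (xs ++ ys) = adjoins (adjoins I xs) ys.
Proof. by rewrite /adjoins foldl_cat. Qed.
Lemma adjoinsC I xs ys : is_ideal I -> {subset xs <= ys} -> {subset ys <= xs} ->
  adjoins I xs = adjoins I ys.
Proof. by move=> iI xy yx; apply/seteqP; split; exact: adjoins_sub2. Qed.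

Lemma ideal_seqE xs : ideal_seq xs = adjoins [set 0] xs.
Proof.
have i0 := ideal_zero; apply/seteqP; split.
  by apply: ideal_seq_sub; [exact: adjoins_ideal | move=> x;
    exact: adjoins_mem].
apply: adjoins_sub; first exact: ideal_seq_ideal.
  by move=> _ ->; exact: ideal0 (ideal_seq_ideal _).
by move=> x; exact: ideal_seq_mem.
Qed.
Lemma ideal_seqC xs ys : {subset xs <= ys} -> {subset ys <= xs} ->
  ideal_seq xs = ideal_seq ys.
Proof. by move=> *; rewrite !ideal_seqE; apply: adjoinsC => //;
  exact: ideal_zero. Qed.
Lemma ideal_seq_rcons xs x : ideal_seq (rcons xs x) = adjoin (ideal_seq xs) x.
Proof. by rewrite !ideal_seqE adjoins_rcons. Qed.

Lemma ideal_pow_ideal I n : is_ideal (ideal_pow I n).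
Proof. by case: n => [//|n]; exact: ideal_gen_ideal. Qed.
Lemma ideal_powS I n x y : I x -> ideal_pow I n y -> ideal_pow I n.+1 (x * y).
Proof. by move=> Ix Iy; apply: ideal_gen_mem; exists x, y. Qed.

Lemma colon_ideal I x : is_ideal I -> is_ideal [set u | I (x * u)].
Proof.
move=> iI; split=> [|u v Iu Iv|a u Iu] /=.
- by rewrite mulr0; exact: ideal0.
- by rewrite mulrDr; exact: idealD.
- by rewrite mulrCA; exact: idealM.
Qed.

Lemma prime_idealX P x k : is_prime_ideal P -> P (x ^+ k) -> P x.
Proof.
case=> iP nP1 Pm; elim: k => [/nP1//|k IH]; rewrite exprS => /Pm[//|].
exact: IH.
Qed.
Lemma radical_prime I P x : is_prime_ideal P -> I `<=` P -> radical I x -> P x.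
Proof. by move=> pP IP [k /IP]; exact: prime_idealX. Qed.
Lemma radical_sub I J : I `<=` J -> radical I `<=` radical J.
Proof. by move=> IJ x [k Ix]; exists k; exact: IJ. Qed.

(** Finitely many elements share one exponent: the sum of individual ones. *)
Lemma radical_uniform_exp I xs : is_ideal I -> (forall x, x \in xs ->
  radical I x) ->
  exists a, forall x, x \in xs -> I (x ^+ a).
Proof.
move=> iI; elim: xs => [|x xs IH] xsI; first by exists 0%N.
have [a Ia] := xsI x (mem_head _ _).
have [|b Ib] := IH; first by move=> y ys; apply: xsI; rewrite inE ys orbT.
exists (a + b)%N => y; rewrite inE exprD => /predU1P[->|/Ib];
  last exact: idealM.
exact: idealMl.
Qed.

End Ideals.

Lemma preimage_ideal (A B : comNzRingType) (f : {rmorphism A ->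
  B}) (I : set B) :
  is_ideal I -> is_ideal (f @^-1` I).
Proof.
move=> iI; split=> [|x y Ix Iy|a x Ix] /=.
- by rewrite rmorph0; exact: ideal0.
- by rewrite rmorphD; exact: idealD.
- by rewrite rmorphM; exact: idealM.
Qed.

Section Span.
Variables (R S : comNzRingType) (i : {rmorphism R -> S}).

Definition span (gs : seq S) : set S :=
  [set y | exists a : nat -> R, y = \sum_(k < size gs) i (a k) * gs`_k].

Lemma span_sub gs : is_sub i (span gs).
Proof.
split=> [|x y [a ->] [b ->]|c x [a ->]].
- by exists (fun=> 0); rewrite big1 // => k _; rewrite rmorph0 mul0r.
- exists (fun k => a k + b k); rewrite -big_split /=; apply: eq_bigr => k _.
  by rewrite rmorphD mulrDl.
- exists (fun k => c * a k); rewrite mulr_sumr; apply: eq_bigr => k _.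
  by rewrite rmorphM mulrA.
Qed.

Lemma span_mem gs g : g \in gs -> span gs g.
Proof.
move=> gs_g; have lt_g : (index g gs < size gs)%N by rewrite index_mem.
exists (fun k => (k == index g gs)%:R); rewrite (bigD1 (Ordinal lt_g)) //=.
rewrite eqxx rmorph1 mul1r nth_index // big1 ?addr0 // => k.
rewrite -val_eqE /= => /negbTE ->.
by rewrite rmorph0 mul0r.
Qed.

Lemma sub_span gs N : is_sub i N -> (forall g, g \in gs -> N g) ->
  span gs `<=` N.
Proof.
move=> sN Ng y [a ->]; apply: (sub_sum sN) => k; apply: (subZ _ sN).
by apply: Ng; rewrite mem_nth.
Qed.

End Span.

Lemma ideal_seq_span (A : comNzRingType) (xs : seq A) :
  ideal_seq xs = span idfun xs.
Proof.
have [s0 sD sM] := span_sub idfun xs; apply/seteqP; split.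
  by apply: ideal_seq_sub; [split | move=> x; exact: span_mem].
apply: sub_span; first exact: (ideal_sub _ (ideal_seq_ideal xs)).
by move=> x; exact: ideal_seq_mem.
Qed.

(** * Primes in Noetherian rings *)

Section Noetherian.
Variable A : comNzRingType.
Hypothesis noeth : noetherian A.
Implicit Types (I J P : set A) (xs : seq A) (Ps : seq (set A)).

Lemma chain_seq_sub (F : set (set A)) X0 xs : total_on F subset -> F X0 ->
  (forall x, x \in xs -> (\bigcup_(X in F) X) x) ->
  exists2 X, F X & (forall x, x \in xs -> X x) /\ X0 `<=` X.
Proof.
move=> Ftot FX0; elim: xs => [|y xs IH] Fxs; first by exists X0 => //; split.
have [X FX [Xxs X0X]] : exists2 X, F X & (forall x, x \in xs ->
  X x) /\ X0 `<=` X.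
  by apply: IH => x xs_x; apply: Fxs; rewrite inE xs_x orbT.
have [Y FY Yy] := Fxs y (mem_head _ _).
have [XY|YX] := Ftot _ _ FX FY.
  exists Y => //; split; last exact: subset_trans XY.
  by move=> x; rewrite inE => /predU1P[->//|/Xxs]; exact: XY.
exists X => //; split=> // x; rewrite inE => /predU1P[->|];
  [exact: YX|exact: Xxs].
Qed.

(** Zorn's lemma applies because the union of a chain of ideals is finitely
generated, hence equal to a member of the chain. *)
Lemma noetherian_maximal (E : set (set A)) I : (forall J, E J -> is_ideal J) ->
  E I -> exists J, [/\ E J, I `<=` J & forall J', E J' -> J `<=` J' -> J' = J].
Proof.
move=> idE EI; pose good J := E J /\ I `<=` J.
(* The empty set is allowed as the union of the empty chain. *)
have [F Fgood Ftot|J [goodJ maxJ]] :=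
    Zorn_bigcup (P := fun X => X = set0 \/ good X).
  have [[X FX goodX]|noX] := pselect (exists2 X, F X & good X); last first.
    left; apply/seteqP; split=> // x [X FX Xx].
    have [X0|gX] := Fgood _ FX; first by rewrite X0 in Xx.
    by case: noX; exists X.
  have idF Y y : F Y -> Y y -> is_ideal Y.
    by move=> FY Yy; have [Y0|[/idE]//] := Fgood _ FY; rewrite Y0 in Yy.
  have idU : is_ideal (\bigcup_(X in F) X).
    split=> [|x y [Y FY Yx] [Z FZ Zy]|a x [Y FY Yx]].
    - by exists X => //; apply: ideal0; apply: idE; case: goodX.
    - have [YZ|ZY] := Ftot _ _ FY FZ.
        by exists Z => //; apply: idealD => //; [exact: idF Zy | exact: YZ].
      by exists Y => //; apply: idealD => //; [exact: idF Yx | exact: ZY].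
    - by exists Y => //; apply: idealM => //; exact: idF Yx.
  have [gs Ugs] := noeth idU.
  have [|Y FY [Ygs XY]] := @chain_seq_sub F X gs Ftot FX.
    by move=> x gs_x; rewrite Ugs; exact: ideal_seq_mem.
  have Y0 : Y 0 by apply: XY; apply: ideal0; apply: idE; case: goodX.
  suff -> : \bigcup_(X in F) X = Y by exact: Fgood.
  apply/seteqP; split=> [|x Yx]; last by exists Y.
  by rewrite Ugs; apply: ideal_seq_sub => //; exact: idF Y0.
have {}goodJ : good J.
  case: goodJ => // J0; case: (maxJ I); last by right; split.
  rewrite J0; split=> // I0; apply: (I0 0); apply: ideal0; exact: idE.
case: goodJ => EJ IJ; exists J; split=> // J' EJ' JJ'.
apply/seteqP; split=> //; apply: contrapT => nJJ'; apply: (maxJ J').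
  by split.
by right; split=> //; exact: subset_trans JJ'.
Qed.

Lemma noetherian_ind (Q : set A -> Prop) :
  (forall I, is_ideal I -> (forall J, is_ideal J -> I `<` J -> Q J) -> Q I) ->
  forall I, is_ideal I -> Q I.
Proof.
move=> step I iI; apply: contrapT => nQI.
have [|J [[iJ nQJ] _ maxJ]] :=
    @noetherian_maximal [set J | is_ideal J /\ ~ Q J] I _ (conj iI nQI).
  by move=> J [].
apply: nQJ; apply: step => // J' iJ' [JJ' nJ'J]; apply: contrapT => nQJ'.
by apply: nJ'J; rewrite (maxJ J').
Qed.

(** An ideal maximal among those that contain I and miss the multiplicative set
M is prime. This replaces passing to a localization. *)
Lemma prime_disjoint (M : set A) I : M 1 ->
  (forall x y, M x -> M y -> M (x * y)) -> is_ideal I -> (forall x, I x ->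
    ~ M x) ->
  exists P, [/\ is_prime_ideal P, I `<=` P & forall x, P x -> ~ M x].
Proof.
move=> M1 MM iI IM.
pose E := [set J : set A | is_ideal J /\ forall x, J x -> ~ M x].
have [|P [[iP PM] IP maxP]] := @noetherian_maximal E I _ (conj iI IM).
  by move=> J [].
have meetM x : ~ P x -> exists2 y, M y & adjoin P x y.
  move=> nPx; apply: contrapT => nM; apply: nPx.
  rewrite -(maxP (adjoin P x)); [exact: adjoin_mem | | exact: adjoin_subl].
  split; first exact: adjoin_ideal.
  by move=> y Py My; apply: nM; exists y.
exists P; split=> //; split=> //; first by move=> /PM.
move=> x y Pxy; apply: contrapT.
move=> /not_orP[/meetM[u Mu [a Pu]] /meetM[v Mv [b Pv]]].
apply: (PM (u * v)); last exact: MM.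
have -> : u * v =
    v * (u - a * x) + a * x * (v - b * y) + a * b * (x * y) by ring.
by apply: idealD => //; [apply: idealD => // |]; exact: idealM.
Qed.

Lemma prime_above I x : is_ideal I -> ~ radical I x ->
  exists P, [/\ is_prime_ideal P, I `<=` P & ~ P x].
Proof.
move=> iI nIx; have [||y Iy [k ykx]|P [pP IP PM]] :=
    @prime_disjoint [set y | exists k, y = x ^+ k] I _ _ iI.
- by exists 0%N.
- by move=> _ _ [k ->] [l ->]; exists (k + l)%N; rewrite exprD.
- by apply: nIx; exists k; rewrite -ykx.
- by exists P; split=> // /PM; apply; exists 1%N.
Qed.

(** By Noetherian induction: if xy is in I with x and y outside, each prime
above I contains I + (x) or I + (y), so the two finite lists can be
concatenated. *)
Lemma finite_minimal_primes I : is_ideal I -> exists Ps : seq (set A),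
  (forall P, P \in Ps -> is_prime_ideal P /\ I `<=` P) /\
  forall P, is_prime_ideal P -> I `<=` P -> exists2 P', P' \in Ps & P' `<=` P.
Proof.
move: I; apply: noetherian_ind => I iI IH.
have [pI|npI] := pselect (is_prime_ideal I).
  exists [:: I]; split=> [P|P _ IP]; last by exists I; rewrite ?mem_head.
  by rewrite inE => /eqP ->; split.
have [I1|nI1] := pselect (I 1).
  by exists [::]; split=> // P [iP nP1 _] IP; case: nP1; exact: IP.
have [x [y [Ixy nIx nIy]]] : exists x y, [/\ I (x * y), ~ I x & ~ I y].
  apply: contrapT => nxy; apply: npI; split=> // x y Ixy.
  by apply: contrapT => /not_orP[nIx nIy]; apply: nxy; exists x, y.
have adj z : ~ I z -> exists Ps : seq (set A),
    (forall P, P \in Ps -> is_prime_ideal P /\ I `<=` P) /\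
    forall P, is_prime_ideal P -> I `<=` P -> P z ->
      exists2 P', P' \in Ps & P' `<=` P.
  move=> nIz; have [//||Ps [PsP Pscov]] := IH (adjoin I z).
    exact: adjoin_ideal.
    exact: adjoin_proper.
  exists Ps; split=> [P /PsP[pP sP]|P pP IP Pz].
    by split=> //; apply: subset_trans sP; exact: adjoin_subl.
  by apply: Pscov => //; apply: adjoin_sub => //; case: pP.
have [Ps [PsP Pscov]] := adj x nIx; have [Qs [QsP Qscov]] := adj y nIy.
exists (Ps ++ Qs); split=> [P|P pP IP].
  by rewrite mem_cat => /orP[/PsP|/QsP].
have [_ _ /(_ x y (IP _ Ixy))[Px|Py]] := pP.
  have [P' P'Ps P'P] := Pscov P pP IP Px.
  by exists P' => //; rewrite mem_cat P'Ps.
have [P' P'Qs P'P] := Qscov P pP IP Py.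
by exists P' => //; rewrite mem_cat P'Qs orbT.
Qed.

End Noetherian.

Section Avoidance.
Variable A : comNzRingType.
Implicit Types (I J P : set A) (Ps : seq (set A)).

Lemma not_subset (X Y : set A) : ~ (X `<=` Y) -> exists2 x, X x & ~ Y x.
Proof.
move=> nXY; apply: contrapT => nex; apply: nXY => x Xx.
by apply: contrapT => nYx; apply: nex; exists x.
Qed.

Lemma separate_prime J P Ps : is_ideal J -> ~ (J `<=` P) -> is_prime_ideal P ->
  (forall P', P' \in Ps -> is_ideal P' /\ ~ (P' `<=` P)) ->
  exists w, [/\ J w, ~ P w & forall P', P' \in Ps -> P' w].
Proof.
move=> iJ nJP pP; elim: Ps => [_|P1 Ps IH PsP].
  by have [w Jw nPw] := not_subset nJP; exists w.
have [P' PsP'|w [Jw nPw Psw]] := IH.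
  by apply: PsP; rewrite inE PsP' orbT.
have [iP1 nP1P] := PsP P1 (mem_head _ _).
have [t P1t nPt] := not_subset nP1P.
exists (t * w); split; [exact: idealM | by case: pP => _ _ pm /pm[] |].
move=> P'; rewrite inE => /predU1P[->|P'Ps]; first exact: idealMl.
have [|iP' _] := PsP P'; first by rewrite inE P'Ps orbT.
by apply: idealM => //; exact: Psw.
Qed.

(** Induction on the number of primes. If some other Q in the list is inside P,
then Q can be dropped, as avoiding P suffices; otherwise z avoiding the tail is
corrected, when it falls into P, by an element of the tail's intersection that
is outside P. *)
Lemma prime_avoidance J Ps : is_ideal J ->
  (forall P, P \in Ps -> is_prime_ideal P /\ ~ (J `<=` P)) ->
  exists2 z, J z & forall P, P \in Ps -> ~ P z.
Proof.
move=> iJ; have [k] := ubnP (size Ps); elim: k Ps => // k IH [_ _|P Ps].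
  by exists 0 => //; exact: ideal0.
rewrite /= ltnS => szPs PsP.
have [pP nJP] := PsP P (mem_head _ _).
have PsP' Q : Q \in Ps -> is_prime_ideal Q /\ ~ (J `<=` Q).
  by move=> QPs; apply: PsP; rewrite inE QPs orbT.
have [[Q QPs QP]|noQ] := pselect (exists2 Q, Q \in Ps & Q `<=` P).
  have remP Q' : Q' \in P :: rem Q Ps -> is_prime_ideal Q' /\ ~ (J `<=` Q').
    rewrite inE => /predU1P[-> //|/mem_rem]; exact: PsP'.
  have szr : (size (P :: rem Q Ps) < k)%N.
    by rewrite /= size_rem // prednK //; case: (Ps) QPs.
  have [z Jz zP] := IH _ szr remP; exists z => // Q'.
  have nPz := zP P (mem_head _ _).
  rewrite inE => /predU1P[->//|Q'Ps].
  have [->|neQ] := eqVneq Q' Q; first by move=> /QP.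
  apply: zP; rewrite inE; apply/orP; right.
  have : Q' \in Q :: rem Q Ps by rewrite -(perm_mem (perm_to_rem QPs)).
  by rewrite inE (negPf neQ).
have [z Jz zP] := IH _ szPs PsP'.
have [Pz|nPz] := pselect (P z); last first.
  by exists z => // Q; rewrite inE => /predU1P[->//|]; exact: zP.
have [|w [Jw nPw Psw]] := @separate_prime J P Ps iJ nJP pP.
  move=> Q QPs; split; first by case: (PsP' _ QPs) => [] [].
  by move=> QP; apply: noQ; exists Q.
exists (z + w); first exact: idealD.
move=> Q; rewrite inE => /predU1P[->|QPs].
  by move=> Pzw; apply: nPw; apply: (@idealDl _ P w z) => //;
    [case: pP | rewrite addrC].
move=> Qzw; apply: (zP Q QPs); apply: idealDl Qzw;
  first by case: (PsP' _ QPs) => [] [].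
exact: Psw.
Qed.

End Avoidance.

(** * Local rings and modules of finite length *)

Section Local.
Variables (R : comNzRingType) (m : set R).
Hypotheses (noeth : noetherian R) (loc : is_local_ring m).
Implicit Types (I J P : set R).

Lemma max_ideal : is_ideal m. Proof. by case: loc => [] []. Qed.
Lemma max_proper : ~ m 1. Proof. by case: loc => [] []. Qed.

Lemma proper_sub_max I : is_ideal I -> ~ I 1 -> I `<=` m.
Proof.
move=> iI nI1.
pose proper := [set J : set R | is_ideal J /\ ~ J 1].
have [|J [[iJ nJ1] IJ maxJ]] :=
    noetherian_maximal (E := proper) noeth _ (conj iI nI1).
  by move=> J [].
suff <- : J = m by [].
by apply: (loc.2); split=> // K iK JK nK1; apply: maxJ.
Qed.

Lemma local_unit x : ~ m x -> exists y, y * x = 1.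
Proof.
move=> nmx; apply: contrapT => nu; apply: nmx.
apply: (@proper_sub_max (adjoin [set 0] x));
  last exact: (adjoin_mem _ (@ideal_zero R)).
  exact: (adjoin_ideal _ (@ideal_zero R)).
by case=> a /= /eqP; rewrite subr_eq0 => /eqP ax1; apply: nu; exists a.
Qed.

Lemma unit_sub1 x : m x -> exists y, y * (1 - x) = 1.
Proof.
move=> mx; apply: local_unit => m1x; apply: max_proper.
exact: (ideal_congr max_ideal m1x mx).
Qed.

Lemma max_prime : is_prime_ideal m.
Proof.
split; [exact: max_ideal | exact: max_proper |] => x y mxy.
have [|/local_unit[u ux]] := pselect (m x); [by left | right].
by rewrite -[y]mul1r -ux -mulrA; exact: (idealM _ max_ideal).
Qed.

Lemma prime_sub_max P : is_prime_ideal P -> P `<=` m.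
Proof. by case=> iP nP1 _; exact: proper_sub_max. Qed.

Lemma prime_proper_max P : is_prime_ideal P -> P <> m -> ~ (m `<=` P).
Proof.
by move=> pP neP mP; apply: neP; apply/seteqP; split=> //; exact: prime_sub_max.
Qed.

Section Nakayama.
Variables (S : comNzRingType) (i : {rmorphism R -> S}).
Implicit Types (N : set S) (gs : seq S).

(** Since 1 - a_0 is a unit, the first generator is eliminated from all the
relations, whose coefficients stay in m. *)
Lemma nakayama N gs : is_sub i N ->
  (forall g, g \in gs -> exists2 a : nat -> R, (forall k, m (a k)) &
     N (g - \sum_(k < size gs) i (a k) * gs`_k)) ->
  forall g, g \in gs -> N g.
Proof.
move=> sN; elim: gs => [//|g gs IH] gsN.
have [a ma Na] := gsN g (mem_head _ _).
have [b b1] := unit_sub1 (ma 0%N).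
pose T (c : nat -> R) := \sum_(k < size gs) i (c k) * gs`_k.
have Ng : N (g - T (fun k => b * a k.+1)).
  have -> : g - T (fun k => b * a k.+1) =
      i b * (g - \sum_(k < (size gs).+1) i (a k) * (g :: gs)`_k).
    rewrite big_ord_recl /= opprD addrA -{2}[g]mul1r -mulrBl.
    rewrite -(rmorph1 i) -rmorphB mulrBr mulrA -rmorphM b1 rmorph1 mul1r.
    congr (_ - _); rewrite /T mulr_sumr; apply: eq_bigr => k _.
    by rewrite rmorphM -mulrA.
  exact: (subZ _ sN).
have gsN' h : h \in gs -> N h.
  apply: IH => {}h gs_h; have [|c mc Nc] := gsN h;
    first by rewrite inE gs_h orbT.
  exists (fun k => c 0%N * (b * a k.+1) + c k.+1).
    by move=> k; apply: (idealD max_ideal) => //; exact: (idealMl _ max_ideal).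
  have -> : h - \sum_(k < size gs) i (c 0%N * (b * a k.+1) + c k.+1) * gs`_k =
      (h - \sum_(k < (size gs).+1) i (c k) * (g :: gs)`_k)
       + i (c 0%N) * (g - T (fun k => b * a k.+1)).
    rewrite big_ord_recl /=.
    have -> : \sum_(k < size gs) i (c 0%N * (b * a k.+1) + c k.+1) * gs`_k =
        i (c 0%N) * T (fun k => b * a k.+1) + T (fun k => c k.+1).
      rewrite /T mulr_sumr -big_split /=; apply: eq_bigr => k _.
      by rewrite rmorphD mulrDl rmorphM mulrA.
    by rewrite -/(T (fun k => c k.+1)); ring.
  by apply: (subD sN) => //; exact: (subZ _ sN).
move=> h; rewrite inE => /predU1P[->|/gsN'//].
rewrite -(subrK (T (fun k => b * a k.+1)) g); apply: (subD sN) => //.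
by apply: (sub_sum sN) => k; apply: (subZ _ sN); apply: gsN'; rewrite mem_nth.
Qed.

(** Nakayama for the R-module S: if S = N + (xs)S with xs in m, then N = S. *)
Lemma nakayama_finite N xs : module_finite i -> is_sub i N ->
  (forall x, x \in xs -> m x) ->
  (forall u, exists2 v, ideal_seq [seq i x | x <- xs] v & N (u - v)) ->
    N = setT.
Proof.
move=> [gs gsP] sN mxs NS.
pose M := [set v | exists2 a : nat -> R, (forall k, m (a k)) &
             v = \sum_(k < size gs) i (a k) * gs`_k].
have sM : is_sub i M.
  split=> [|x y [a ma ->] [b mb ->]|c x [a ma ->]].
  - exists (fun=> 0); first by move=> _; exact: ideal0 max_ideal.
    by rewrite big1 // => k _; rewrite rmorph0 mul0r.
  - exists (fun k => a k + b k); first by move=> k; exact: (idealD max_ideal).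
    by rewrite -big_split /=; apply: eq_bigr => k _; rewrite rmorphD mulrDl.
  - exists (fun k => c * a k); first by move=> k; exact: (idealM _ max_ideal).
    by rewrite mulr_sumr; apply: eq_bigr => k _; rewrite rmorphM mulrA.
have MS r u : m r -> M (i r * u).
  move=> mr; have [a ->] := gsP u; exists (fun k => r * a k).
    by move=> k; exact: (idealMl _ max_ideal).
  by rewrite mulr_sumr; apply: eq_bigr => k _; rewrite rmorphM mulrA.
have Ngs : forall g, g \in gs -> N g.
  apply: nakayama => // g _; have [v] := NS g.
  rewrite ideal_seq_span => -[b vE] Nv.
  have [a ma va] : M v.
    rewrite vE; apply: (sub_sum sM) => k; rewrite mulrC.
    have ltk : (k < size xs)%N by rewrite -(size_map i).
    by rewrite (nth_map 0) //; apply: MS; apply: mxs; rewrite mem_nth.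
  by exists a => //; rewrite -va.
apply/seteqP; split=> // u _; have [a ->] := gsP u.
by apply: (sub_sum sN) => k; apply: (subZ _ sN); apply: Ngs; rewrite mem_nth.
Qed.

End Nakayama.

(** Nakayama for K = I + xK. *)
Lemma nakayama_ideal I K x : is_ideal I -> is_ideal K -> m x ->
  (forall u, K u -> exists2 v, K v & I (u - x * v)) -> K `<=` I.
Proof.
move=> iI iK mx KI; have [gs Kgs] := noeth iK.
rewrite Kgs; apply: ideal_seq_sub => //.
apply: (nakayama (i := idfun)); first exact: ideal_sub.
move=> g gs_g; have [v] : exists2 v, K v & I (g - x * v).
  by apply: KI; rewrite Kgs; exact: ideal_seq_mem.
rewrite Kgs ideal_seq_span => -[a ->] Ia; exists (fun k => x * a k).
  by move=> k; exact: (idealMl _ max_ideal).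
rewrite mulr_sumr in Ia; congr (I (_ - _)): Ia; apply: eq_bigr => k _ /=.
by rewrite mulrA.
Qed.

End Local.

Section FiniteLength.
Variables (R S : comNzRingType) (i : {rmorphism R -> S}) (m : set R).
Hypotheses (noeth : noetherian R) (loc : is_local_ring m).
Hypothesis fin : module_finite i.
Implicit Types (N : set S).

Let iD g : forall x y, i (x + y) * g = i x * g + i y * g.
Proof. by move=> x y; rewrite rmorphD mulrDl. Qed.
Let iZ g : forall a x, i (idfun a * x) * g = i a * (i x * g).
Proof. by move=> a x; rewrite rmorphM mulrA. Qed.

Lemma colength_le_max : colength_le idfun m 1.
Proof.
case=> [//|[//|n]] [X [sX [_ nXm] [Y [_ [_ nYX] _]]]]; case: nYX.
have iX : is_ideal X by [].
rewrite (ideal1 iX) //; apply: contrapT => nX1; apply: nXm.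
exact: (proper_sub_max noeth loc iX).
Qed.

(** Adjoining one generator g at a time, each step is a quotient of R/m through
r |-> r g. *)
Lemma colength_le_killed N gs : is_sub i N ->
  (forall r u, m r -> N (i r * u)) ->
  (forall M, is_sub i M -> N `<=` M -> (forall g, g \in gs -> M g) ->
     M = setT) ->
  colength_le i N (size gs).
Proof.
elim: gs N => [|g gs IH] N sN kN gN.
  by rewrite (gN N) //; exact: colength_le_full.
pose f r := i r * g; pose N' := sum_image f N setT.
have sN' : is_sub i N' by apply: (sub_sum_image (iD g) (iZ g)).
have NN' : N `<=` N' by exact: (sum_image_subl (iZ g) (i := idfun)).
apply: (colength_le_add (iD g) (iZ g) sN (a := 1)).
  by apply: colength_le_sub colength_le_max => r mr; exact: kN.
apply: IH => // [r u mr|M sM N'M Mgs]; first by apply: NN'; exact: kN.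
apply: gN => //; first exact: subset_trans N'M.
move=> h; rewrite inE => /predU1P[->|]; last exact: Mgs.
apply: N'M; exists 1 => //; rewrite /f rmorph1 mul1r subrr; exact: sub0 sN.
Qed.

Let mulD (x : S) : forall u v, x * (u + v) = x * u + x * v.
Proof. by move=> u v; rewrite mulrDr. Qed.
Let mulZ (x : S) : forall a u, x * (i a * u) = i a * (x * u).
Proof. by move=> a u; rewrite mulrCA. Qed.

Lemma adjoinE N x : adjoin N x = sum_image (fun u => x * u) N setT.
Proof.
apply/seteqP; split=> y [a]; first by exists a; rewrite // mulrC.
by move=> _ Na; exists a; rewrite mulrC.
Qed.

Lemma colength_le_colon N x a b : is_ideal N ->
  colength_le i [set u | N (x * u)] a -> colength_le i (adjoin N x) b ->
  colength_le i N (a + b).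
Proof.
move=> iN ba; rewrite adjoinE; apply: (colength_le_add (mulD x) (mulZ x)) => //.
exact: ideal_sub.
Qed.

(** Multiplication by x identifies S/(N : x) with (N + xS)/N. *)
Lemma colength_colon N x a b : is_ideal N ->
  colength i [set u | N (x * u)] a -> colength i (adjoin N x) b ->
  colength i N (a + b).
Proof.
move=> iN ba; rewrite adjoinE; apply: (colength_add (mulD x) (mulZ x)) => //.
exact: ideal_sub.
Qed.

(** Each (N + x^k S)/(N + x^{k+1} S) is a quotient of S/(N + xS). *)
Lemma colength_le_pow N x a l : is_ideal N -> N (x ^+ a) ->
  colength_le i (adjoin N x) l -> colength_le i N (a * l).
Proof.
elim: a N => [|a IH] N iN Nxa bl.
  by rewrite (ideal1 iN Nxa); exact: colength_le_full.
rewrite mulSn addnC; apply: colength_le_colon (bl) => //.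
have iC := colon_ideal x iN.
apply: IH => //; first by rewrite /= -exprS.
apply: colength_le_sub bl; apply: adjoin_sub; first exact: adjoin_ideal.
  by apply: (subset_trans _ (@adjoin_subl _ _ _)) => u Nu; exact: idealM.
exact: adjoin_mem.
Qed.

Lemma colength_le_pows N xs a l : is_ideal N ->
  (forall x, x \in xs -> N (x ^+ a)) ->
  colength_le i (adjoins N xs) l -> colength_le i N (a ^ size xs * l).
Proof.
elim: xs N => [|x xs IH] N iN Nxs /= bl; first by rewrite expn0 mul1n.
rewrite expnS -mulnA; apply: (@colength_le_pow _ x) => //.
  by apply: Nxs; rewrite mem_head.
apply: IH => //; first exact: adjoin_ideal.
by move=> y xs_y; apply: adjoin_subl; apply: Nxs; rewrite inE xs_y orbT.
Qed.

(** Some power of each generator of m lands in N, which reduces to the case of a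
finitely generated module killed by m. *)
Lemma finite_length N : is_ideal N -> m `<=` radical (i @^-1` N) ->
  exists l, colength_le i N l.
Proof.
move=> iN mN; have [ms mms] := noeth (max_ideal loc).
have [a aN] : exists a, forall x, x \in ms -> N (i x ^+ a).
  have [|a aN] := radical_uniform_exp (xs := ms) (preimage_ideal i iN).
    by move=> x ms_x; apply: mN; rewrite mms; exact: ideal_seq_mem.
  by exists a => x /aN; rewrite /= rmorphXn.
have [gs gsP] := fin.
exists (a ^ size [seq i x | x <- ms] * size gs)%N;
  apply: colength_le_pows => //.
  by move=> _ /mapP[x ms_x ->]; exact: aN.
have iN' := adjoins_ideal [seq i x | x <- ms] iN.
apply: colength_le_killed; first exact: ideal_sub.
  move=> r u; rewrite mms ideal_seq_span => -[b ->];
    rewrite rmorph_sum mulr_suml.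
  apply: ideal_sum => // k; rewrite rmorphM -mulrA; apply: idealM => //.
  by apply: idealMl => //; apply: adjoins_mem => //; apply: map_f;
    rewrite mem_nth.
move=> M sM _ Mgs; apply/seteqP; split=> // u _; have [b ->] := gsP u.
by apply: (sub_sum sM) => k; apply: (subZ _ sM); apply: Mgs; rewrite mem_nth.
Qed.

End FiniteLength.

(** * Dimension and systems of parameters *)

Section Dimension.
Variables (R : comNzRingType) (m : set R).
Hypotheses (noeth : noetherian R) (loc : is_local_ring m).
Implicit Types (I J P : set R) (xs ys : seq R).

(** The dimension of R/I is at most k. *)
Definition dim_le I k := forall P n,
  is_prime_ideal P -> I `<=` P -> ascends (@is_prime_ideal R) P n -> (n <= k)%N.

Lemma krull_dim_le d : krull_dim R d -> dim_le [set 0] d.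
Proof.
move=> [_ maxd] P n pP _ /(ascends_strict_chain pP)[C chC _].
by apply: maxd; exists C.
Qed.

Lemma ascends_max n : ascends (@is_prime_ideal R) m n -> n = 0%N.
Proof.
case: n => [//|n] [P [pP [_ nPm] _]]; case: nPm.
exact: (prime_sub_max noeth loc pP).
Qed.

Lemma dim_le_adjoin I x k : dim_le I k.+1 ->
  (forall P, is_prime_ideal P -> adjoin I x `<=` P ->
     P = m \/ exists P0, [/\ is_prime_ideal P0, I `<=` P0 & P0 `<` P]) ->
  dim_le (adjoin I x) k.
Proof.
move=> dI low P n pP IP chP; have [Pm|[P0 [pP0 IP0 P0P]]] := low P pP IP.
  by rewrite Pm in chP; rewrite (ascends_max chP).
by rewrite -ltnS; apply: (dI P0) => //; exists P.
Qed.

(** x is a nonzerodivisor on R/I. *)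
Definition nzd I x := forall u, I (x * u) -> I u.

Lemma nzdX I x k : nzd I x -> nzd I (x ^+ k).
Proof.
move=> nx; elim: k => [|k IH] u; first by rewrite mul1r.
by rewrite exprS -mulrA => /nx/IH.
Qed.

(** Minimal primes consist of zero divisors: the products t x^k with t outside P
avoid I, and a prime containing I and avoiding them is inside P but misses x. *)
Lemma nzd_not_minimal I x P : is_ideal I -> nzd I x -> is_prime_ideal P ->
  I `<=` P -> P x -> exists P0, [/\ is_prime_ideal P0, I `<=` P0 & P0 `<` P].
Proof.
move=> iI nx pP IP Px; have [iP nP1 Pm] := pP.
have [||u Iu [t [k [nPt ut]]]|P0 [pP0 IP0 P0M]] :=
    @prime_disjoint R noeth [set u | exists t k, ~ P t /\ u = t * x ^+ k] I _ _
      iI.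
- by exists 1, 0%N; rewrite mulr1.
- move=> _ _ [t [k [nPt ->]]] [t' [k' [nPt' ->]]]; exists (t * t'), (k + k')%N.
  by split; [move=> /Pm[] | rewrite exprD mulrACA].
- by apply: nPt; apply: IP; apply: (nzdX (k := k) nx); rewrite mulrC -ut.
- exists P0; split=> //; split=> [u P0u|PP0].
    apply: contrapT => nPu; apply: (P0M u P0u).
    by exists u, 0%N; rewrite mulr1.
  by apply: (P0M x (PP0 _ Px)); exists 1, 1%N; rewrite mul1r.
Qed.

Lemma dim_le_nzd I x k : is_ideal I -> nzd I x -> dim_le I k.+1 ->
  dim_le (adjoin I x) k.
Proof.
move=> iI nx dI; apply: dim_le_adjoin => // P pP IP; right.
apply: (nzd_not_minimal iI nx) => //.
  exact: subset_trans (@adjoin_subl _ _ _) IP.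
by apply: IP; exact: adjoin_mem.
Qed.

(** A prime above I that misses an element of m would start the chain P < m. *)
Lemma dim_le0_primary I : is_ideal I -> dim_le I 0 -> m `<=` radical I.
Proof.
move=> iI dI x mx; apply: contrapT => nIx.
have [P [pP IP nPx]] := prime_above noeth iI nIx.
suff: (1 <= 0)%N by [].
apply: (dI P) => //; exists m; split=> //; first exact: (max_prime noeth loc).
by split; [exact: (prime_sub_max noeth loc) | move=> mP; apply: nPx; exact: mP].
Qed.

(** By prime avoidance, z in m can be taken outside all minimal primes of I and
J other than m. Then no prime containing z, except m, is minimal over I or J.
Two ideals are treated at once for the sake of [params_swap]. *)
Lemma avoid_minimal_primes I J : is_ideal I -> is_ideal J ->
  exists2 z, m z & forall P, is_prime_ideal P -> P z -> P <> m ->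
    (I `<=` P -> exists P0, [/\ is_prime_ideal P0, I `<=` P0 & P0 `<` P]) /\
    (J `<=` P -> exists P0, [/\ is_prime_ideal P0, J `<=` P0 & P0 `<` P]).
Proof.
move=> iI iJ.
have [Ps [PsP Pscov]] := finite_minimal_primes noeth iI.
have [Qs [QsP Qscov]] := finite_minimal_primes noeth iJ.
have [|z mz zP] :=
  @prime_avoidance R m [seq P <- Ps ++ Qs | P != m] (max_ideal loc).
  move=> P; rewrite mem_filter mem_cat => /andP[/eqP neP PPQ].
  have pP : is_prime_ideal P by case/orP: PPQ => [/PsP[]|/QsP[]].
  by split=> //; exact: (prime_proper_max noeth loc).
have low P P' : is_prime_ideal P -> P z -> P <> m -> is_prime_ideal P' ->
    P' \in Ps ++ Qs -> P' `<=` P -> P' `<` P.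
  move=> pP Pz neP pP' P'PQ P'P; split=> // PP'.
  apply: (zP P'); last exact: PP'.
  rewrite mem_filter P'PQ andbT; apply/eqP => P'm;
    apply: (prime_proper_max noeth loc pP neP).
  by rewrite -P'm.
exists z => // P pP Pz neP; split=> [IP|JP].
  have [P' P'Ps P'P] := Pscov P pP IP; have [pP' IP'] := PsP P' P'Ps.
  by exists P'; split=> //; apply: low => //; rewrite mem_cat P'Ps.
have [P' P'Qs P'P] := Qscov P pP JP; have [pP' JP'] := QsP P' P'Qs.
by exists P'; split=> //; apply: low => //; rewrite mem_cat P'Qs orbT.
Qed.

Lemma extend_to_primary I k : is_ideal I -> dim_le I k -> exists ys,
  [/\ size ys = k, forall y, y \in ys -> m y & m `<=` radical (adjoins I ys)].
Proof.
elim: k I => [|k IH] I iI dI.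
  by exists [::]; split=> //; exact: dim_le0_primary.
have [z mz zP] := avoid_minimal_primes iI iI.
have [|ys [szy mys prim]] := IH (adjoin I z) (adjoin_ideal z iI).
  apply: dim_le_adjoin => // P pP IP; have [->|neP] := pselect (P = m);
    first by left.
  right; have Pz : P z by apply: IP; exact: adjoin_mem.
  have [low _] := zP P pP Pz neP; apply: low.
  exact: subset_trans (@adjoin_subl _ _ _) IP.
exists (z :: ys); split=> //=; first by rewrite szy.
by move=> y; rewrite inE => /predU1P[->//|]; exact: mys.
Qed.

Lemma colength_le_primary I : is_ideal I -> m `<=` radical I ->
  exists l, colength_le idfun I l.
Proof.
move=> iI mI; apply: (finite_length noeth loc) => //.
by exists [:: 1] => y; exists (fun=> y); rewrite big_ord1 /= mulr1.
Qed.

(** Krull's principal ideal theorem for the domain R/P0. Take w in P outside P0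
and let a_n be the contraction of (w^n) from the local ring at P. As R/(P0 +
(x)) has finite length, a_n + (x) becomes stationary; since x is outside P, this
reads a_n = a_{n+1} + x a_n, so a_n = a_{n+1} by Nakayama. Then t w^n is in
(w^{n+1}) for some t outside P, and cancelling w^n puts t in (w), inside P. *)
Lemma krull_principal P0 P x : is_prime_ideal P0 -> m x ->
  m `<=` radical (adjoin P0 x) -> is_prime_ideal P -> P0 `<` P -> P = m.
Proof.
move=> pP0 mx prim pP [P0P nPP0]; apply: contrapT => neP.
have [iP0 nP01 P0m] := pP0; have [iP nP1 Pm] := pP.
have nPx : ~ P x.
  move=> Px; apply: (prime_proper_max noeth loc pP neP).
  apply: (subset_trans prim) => y; apply: radical_prime => //.
  exact: adjoin_sub.
have [w Pw nP0w] := not_subset nPP0.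
pose a n := [set u | exists2 t, ~ P t & adjoin P0 (w ^+ n) (t * u)].
have ia n : is_ideal (a n).
  have iA := adjoin_ideal (w ^+ n) iP0.
  split=> [|u v [t nPt tu] [t' nPt' tv]|c u [t nPt tu]].
  - by exists 1 => //; rewrite mulr0; exact: ideal0.
  - exists (t * t'); first by move=> /Pm[].
    rewrite mulrDr; apply: idealD => //; last by rewrite -mulrA; exact: idealM.
    by rewrite mulrAC; exact: idealMl.
  - by exists t => //; rewrite mulrCA; exact: idealM.
have P0a n : P0 `<=` a n.
  by move=> u P0u; exists 1 => //; rewrite mul1r; exact: adjoin_subl.
have dec n : a n.+1 `<=` a n.
  move=> u [t nPt tu]; exists t => //; apply: adjoin_sub tu.
  - exact: adjoin_ideal.
  - exact: adjoin_subl.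
  - by rewrite exprS; apply: idealM; [exact: adjoin_ideal | exact: adjoin_mem].
have iPx := adjoin_ideal x iP0.
have [l bl] := colength_le_primary iPx prim.
have [n stab] : exists n, adjoin (a n) x `<=` adjoin (a n.+1) x.
  apply: (colength_le_stable bl) => n;
    first exact: (ideal_sub idfun (adjoin_ideal x (ia n))).
    apply: adjoin_sub; [exact: adjoin_ideal | | exact: adjoin_mem].
    by apply: (subset_trans (P0a n)); exact: adjoin_subl.
  apply: adjoin_sub; [exact: adjoin_ideal | | exact: adjoin_mem].
  by apply: (subset_trans (dec n)); exact: adjoin_subl.
have sa : a n `<=` a n.+1.
  apply: (nakayama_ideal noeth loc (ia _) (ia _) mx) => u au.
  have [r ar] := stab u (adjoin_subl x au).
  exists r; last by rewrite mulrC.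
  have [t nPt txr] : a n (x * r).
    have -> : x * r = u - (u - r * x) by ring.
    by apply: idealB => //; exact: dec.
  exists (t * x); first by move=> /Pm[].
  by rewrite -mulrA.
have [t nPt [r]] : a n.+1 (w ^+ n).
  by apply: sa; exists 1 => //; rewrite mul1r; exact: adjoin_mem.
have -> : t * w ^+ n - r * w ^+ n.+1 = (t - r * w) * w ^+ n.
  by rewrite exprS; ring.
case/P0m=> [P0t|/(prime_idealX pP0)//].
apply: nPt; apply: (ideal_congr iP (P0P _ P0t)); exact: idealM.
Qed.

(** A system of parameters, once its size is the dimension of R. *)
Definition params xs :=
  (forall x, x \in xs -> m x) /\ m `<=` radical (ideal_seq xs).

(** Choose z outside the minimal primes of I and of J other than m. A prime P <
m containing I and z would lie strictly between m and a prime P0 above I,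
although m is minimal over P0 + (x). *)
Lemma params_swap I J x y : is_ideal I -> is_ideal J -> m x -> m y ->
  m `<=` radical (adjoin I x) -> m `<=` radical (adjoin J y) ->
  exists z, [/\ m z, m `<=` radical (adjoin I z) & m `<=` radical (adjoin J z)].
Proof.
move=> iI iJ mx my prx pry; have [z mz zP] := avoid_minimal_primes iI iJ.
have key K w : is_ideal K -> m w -> m `<=` radical (adjoin K w) ->
    (forall P, is_prime_ideal P -> P z -> P <> m -> K `<=` P ->
       exists P0, [/\ is_prime_ideal P0, K `<=` P0 & P0 `<` P]) ->
    m `<=` radical (adjoin K z).
  move=> iK mw prw low v mv; apply: contrapT => nv.
  have [P [pP KP nPv]] := prime_above noeth (adjoin_ideal z iK) nv.
  have neP : P <> m by move=> Pm; apply: nPv; rewrite Pm.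
  have Pz : P z by apply: KP; exact: adjoin_mem.
  have [|P0 [pP0 KP0 P0P]] := low P pP Pz neP.
    exact: subset_trans (@adjoin_subl _ _ _) KP.
  apply: neP; apply: (@krull_principal P0 P w) => //.
  apply: (subset_trans prw); apply: radical_sub.
  have iP0 : is_ideal P0 by case: pP0.
  apply: adjoin_sub; [exact: adjoin_ideal | | exact: adjoin_mem].
  by apply: (subset_trans KP0); exact: adjoin_subl.
exists z; split=> //.
  by apply: (key I x) => // P pP Pz neP; case: (zP P pP Pz neP).
by apply: (key J y) => // P pP Pz neP; case: (zP P pP Pz neP).
Qed.

Lemma params_perm xs ys : perm_eq xs ys -> params xs -> params ys.
Proof.
move=> pxy [mxs prx]; split=> [y|]; first by rewrite -(perm_mem pxy);
  exact: mxs.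
by rewrite (@ideal_seqC _ ys xs) // => y; rewrite (perm_mem pxy).
Qed.

(** Induction on the number of elements in which the two systems differ: by
[params_swap] there is a z that can replace both x in (zs, x, xs) and y in (zs,
y, ys), and then one more element is shared. *)
Lemma params_connected (T : seq R -> Prop) :
  (forall xs ys, perm_eq xs ys -> params xs -> T xs -> T ys) ->
  (forall zs x y, params (rcons zs x) -> params (rcons zs y) ->
     T (rcons zs x) -> T (rcons zs y)) ->
  forall xs ys, size xs = size ys -> params xs -> params ys -> T xs -> T ys.
Proof.
move=> Tperm Tswap xs ys; suff gen k zs : forall xs ys,
    size xs = k -> size ys = k ->
    params (zs ++ xs) -> params (zs ++ ys) -> T (zs ++ xs) -> T (zs ++ ys).
  by move=> szxy; apply: (gen (size ys) [::]).
elim: k zs => [|k IH] zs {}xs {}ys; first by move=> /size0nil-> /size0nil->.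
case: xs => [//|x xs] [szx]; case: ys => [//|y ys] [szy] pxs pys Txs.
have mid (w : R) ws : perm_eq (zs ++ w :: ws) (rcons (zs ++ ws) w).
  by rewrite -cats1 -catA perm_cat2l cats1 perm_sym perm_rcons.
have mid' (w : R) ws : perm_eq (rcons (zs ++ ws) w) (rcons zs w ++ ws).
  by rewrite cat_rcons perm_sym mid.
have pxs' := params_perm (mid x xs) pxs.
have pys' := params_perm (mid y ys) pys.
have m_last ws w : params (rcons ws w) -> m w.
  by move=> [mw _]; apply: mw; rewrite mem_rcons mem_head.
have [z [mz pxz pyz]] : exists z, [/\ m z,
    m `<=` radical (adjoin (ideal_seq (zs ++ xs)) z)
    & m `<=` radical (adjoin (ideal_seq (zs ++ ys)) z)].
  apply: (@params_swap _ _ x y); rewrite -?ideal_seq_rcons;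
    try exact: ideal_seq_ideal.
  - exact: m_last pxs'.
  - exact: m_last pys'.
  - by case: pxs'.
  - by case: pys'.
have addz ws w : params (rcons ws w) ->
    m `<=` radical (adjoin (ideal_seq ws) z) -> params (rcons ws z).
  move=> [mws _] prz; split; last by rewrite ideal_seq_rcons.
  move=> v; rewrite mem_rcons inE => /predU1P[->//|ws_v].
  by apply: mws; rewrite mem_rcons inE ws_v orbT.
have pxz' := addz _ _ pxs' pxz; have pyz' := addz _ _ pys' pyz.
have Tz : T (rcons zs z ++ xs).
  apply: (Tperm _ _ (mid' z xs)) => //; apply: (Tswap _ x) => //.
  exact: Tperm (mid x xs) pxs Txs.
have pz := params_perm (mid' z xs) pxz'.
have pz' := params_perm (mid' z ys) pyz'.
have {}Tz := IH _ _ _ szx szy pz pz' Tz.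
have midC : perm_eq (rcons (zs ++ ys) y) (zs ++ y :: ys).
  by rewrite perm_sym mid.
apply: (Tperm _ _ midC pys'); apply: (Tswap _ z) => //.
by apply: (Tperm _ _ _ pz' Tz); rewrite perm_sym; exact: mid'.
Qed.

End Dimension.

(** A chain of primes above P extends a chain below P, and the latter can have
length at least h. *)
Lemma dim_le_height (R : comNzRingType) (I : set R) d h : krull_dim R d ->
  ideal_height I h -> (h <= d)%N /\ dim_le I (d - h)%N.
Proof.
move=> [_ maxd] [[P0 [pP0 IP0 [[C0 chC0 _] _]]] htI].
have chain P k : is_prime_ideal P -> I `<=` P ->
    ascends (@is_prime_ideal R) P k -> (h + k <= d)%N.
  move=> pP IP chP.
  have ext n C : strict_chain (@is_prime_ideal R) n C -> C n = P ->
      (n + k <= d)%N.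
    move=> chC CP; have := strict_chain_ascends (k := k) chC.
    rewrite CP => /(_ chP)/(ascends_strict_chain (chC.1 0%N (leq0n _))).
    by move=> [D chD _]; apply: maxd; exists D.
  have [|k' []|ht [htP maxP]] := @bounded_maximum
      [set n | exists2 C, strict_chain (@is_prime_ideal R) n C & C n = P] d.
  - by exists (fun=> P) => //; split.
  - by move=> C chC CP; apply: leq_trans (ext _ _ chC CP); exact: leq_addr.
  - apply: (@leq_trans (ht + k)); first by rewrite leq_add2r; exact: (htI P).
    by have [C chC CP] := htP; exact: ext chC CP.
split; first by have := chain P0 0%N pP0 IP0 Logic.I; rewrite addn0.
move=> P k pP IP /(chain _ _ pP IP) lehk.
by rewrite leq_subRL // (leq_trans (leq_addr k h)).
Qed.

(** * Regular sequences and powers of their ideals *)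

Section Regular.
Variable S : comNzRingType.
Implicit Types (I J : set S) (xs ys : seq S).

(** Regularity of xs on the quotient by I, without the condition that I + (xs)
be proper. *)
Fixpoint regular_mod I xs : Prop :=
  if xs is x :: xs' then nzd I x /\ regular_mod (adjoin I x) xs' else True.

(** xs is regular in any order. Unlike regularity, this passes to subsequences,
which the inductions on powers of (xs) need. *)
Definition perm_regular I xs := forall ys, perm_eq ys xs -> regular_mod I ys.

Lemma regular_mod_cat I xs ys :
  regular_mod I (xs ++ ys) <-> regular_mod I xs /\ regular_mod (adjoins I xs)
    ys.
Proof.
elim: xs I => [|x xs IH] I /=; first by split=> [|[]].
by split=> [[nx /IH[]]|[[nx rx] ry]]; split=> //; apply/IH.
Qed.

Lemma regular_mod_rcons I xs x :
  regular_mod I (rcons xs x) <-> regular_mod I xs /\ nzd (adjoins I xs) x.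
Proof.
rewrite -cats1; split=> [/regular_mod_cat[rx []]|[rx nx]] //.
by apply/regular_mod_cat.
Qed.

Lemma regular_sequence_mod0 xs : regular_sequence xs -> regular_mod [set 0] xs.
Proof.
move=> [_ rxs].
have {rxs} : forall k, (k < size xs)%N ->
  nzd (adjoins [set 0] (take k xs)) xs`_k.
  by move=> k ltk u; rewrite -ideal_seqE; exact: rxs.
elim: xs [set 0] => [//|x xs IH] I rxs /=; split; first exact: (rxs 0%N).
by apply: IH => k ltk; exact: (rxs k.+1).
Qed.

Lemma perm_regular_nzd I x xs : perm_regular I (x :: xs) -> nzd I x.
Proof. by move/(_ _ (perm_refl _)) => []. Qed.
Lemma perm_regular_tail I x xs : perm_regular I (x :: xs) -> perm_regular I xs.
Proof.
move=> rI ys pys; have /regular_mod_rcons[] // : regular_mod I (rcons ys x).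
by apply: rI; rewrite perm_rcons perm_cons.
Qed.
Lemma perm_regular_adjoin I x xs : perm_regular I (x :: xs) ->
  perm_regular (adjoin I x) xs.
Proof.
move=> rI ys pys; have [] // : regular_mod I (x :: ys).
by apply: rI; rewrite perm_cons.
Qed.

End Regular.

Section RegularLocal.
Variables (S : comNzRingType) (m : set S).
Hypotheses (noeth : noetherian S) (loc : is_local_ring m).
Implicit Types (I J : set S) (xs ys : seq S).

(** The ideal K = (I : y) satisfies K = I + xK, so it is I by Nakayama. *)
Lemma regular_mod_swap I x y xs : is_ideal I -> m x ->
  regular_mod I [:: x, y & xs] -> regular_mod I [:: y, x & xs].
Proof.
move=> iI mx /= [nx [ny rxs]]; have iC := colon_ideal y iI; split; last split.
- move=> u; apply: (nakayama_ideal noeth loc iI iC mx) => {}u /= Iyu.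
  have [v Iuv] : adjoin I x u by apply: ny; exact: adjoin_subl.
  exists v; last by rewrite mulrC.
  apply: nx; have -> : x * (y * v) = y * u - y * (u - v * x) by ring.
  by apply: idealB => //; exact: idealM.
- move=> u [a Ixu]; have [b Iab] : adjoin I x a.
    apply: ny; exists u; have -> : y * a - u * x = - (x * u - a * y) by ring.
    exact: idealN.
  exists b; apply: nx.
  have -> : x * (u - b * y) = (x * u - a * y) + y * (a - b * x) by ring.
  by apply: idealD => //; exact: idealM.
- suff <- : adjoin (adjoin I x) y = adjoin (adjoin I y) x by [].
  by apply: (@adjoinsC _ I [:: x; y] [:: y; x]) => // z; rewrite !inE orbC.
Qed.

Lemma regular_mod_front I x xs ys : is_ideal I -> (forall z, z \in xs -> m z) ->
  regular_mod I (xs ++ x :: ys) -> regular_mod I (x :: xs ++ ys).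
Proof.
elim: xs I => [//|z xs IH] I iI mxs [nz /IH rz] /=.
apply: (@regular_mod_swap I z x) => //; first by apply: mxs; rewrite mem_head.
split=> //; apply: rz; first exact: adjoin_ideal.
by move=> w xs_w; apply: mxs; rewrite inE xs_w orbT.
Qed.

Lemma regular_mod_perm I xs ys : is_ideal I -> (forall z, z \in xs -> m z) ->
  perm_eq xs ys -> regular_mod I xs -> regular_mod I ys.
Proof.
elim: ys I xs => [//|y ys IH] I xs iI mxs pxy rxs.
have xs_y : y \in xs by rewrite (perm_mem pxy) mem_head.
case/splitPr: xs_y mxs pxy rxs => us vs mxs pxy rxs.
have [|ny ry] := @regular_mod_front I y us vs iI _ rxs.
  by move=> z us_z; apply: mxs; rewrite mem_cat us_z.
split=> //; apply: IH ry; first exact: adjoin_ideal.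
  move=> z; rewrite mem_cat => zuv; apply: mxs; rewrite mem_cat inE.
  by case/orP: zuv => ->; rewrite ?orbT.
rewrite -(perm_cons y); apply: perm_trans pxy.
by rewrite -(cat1s y (us ++ vs)) -(cat1s y vs) perm_catCA.
Qed.

(** Each member of a regular sequence lowers the dimension, which reaches 0. *)
Lemma regular_mod_primary I xs : is_ideal I -> regular_mod I xs ->
  dim_le I (size xs) -> m `<=` radical (adjoins I xs).
Proof.
elim: xs I => [|x xs IH] I iI /=; first by move=> _; exact: dim_le0_primary.
move=> [nx rx] dI; apply: IH => //; first exact: adjoin_ideal.
exact: (dim_le_nzd noeth loc).
Qed.

(** Along the path of [params_connected] only the last element changes, from x
to y. As x^k is in (zs, y), an annihilator of y modulo (zs) is annihilated by
x^k, hence is zero modulo (zs). *)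
Lemma params_perm_regular xs ys : size xs = size ys ->
  params m xs -> params m ys -> regular_mod [set 0] xs ->
    perm_regular [set 0] ys.
Proof.
have i0 := @ideal_zero S; move=> szxy pxs pys rxs.
suff rys : regular_mod [set 0] ys.
  by move=> zs pzs; apply: (regular_mod_perm i0 pys.1) rys; rewrite perm_sym.
apply: (params_connected noeth loc (T := regular_mod [set 0])) rxs => //.
  by move=> us vs puv [mus _]; exact: regular_mod_perm.
move=> zs x y [mzs _] [_ prz] /regular_mod_rcons[rzs nx];
  apply/regular_mod_rcons; split=> // u zsyu.
have [k] : radical (ideal_seq (rcons zs y)) x.
  by apply: prz; apply: mzs; rewrite mem_rcons mem_head.
rewrite ideal_seq_rcons ideal_seqE => -[a zsx].
have iz := adjoins_ideal zs i0; apply: (nzdX (k := k) nx).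
have -> : x ^+ k * u = (x ^+ k - a * y) * u + a * (y * u) by ring.
by apply: idealD => //; [exact: idealMl | exact: idealM].
Qed.

End RegularLocal.

(** A regular sequence of length dim S is a system of parameters, and all the
others are linked to it. *)
Lemma cohen_macaulay_regular (S : comNzRingType) (n : set S) d xs :
  cohen_macaulay_local n -> krull_dim S d -> size xs = d -> params n xs ->
  perm_regular [set 0] xs.
Proof.
move=> [noeth loc [d' dim_d' [[bs [szb bn rb]] _]]] dim_d szx pxs.
have dd' : d' = d by exact: is_maximum_uniq dim_d' dim_d.
have rbs := regular_sequence_mod0 rb.
apply: (params_perm_regular noeth loc (xs := bs)) => //;
  first by rewrite szb szx.
split; first exact: bn.
rewrite ideal_seqE; apply: (regular_mod_primary noeth loc (@ideal_zero S) rbs).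
by rewrite szb dd'; exact: krull_dim_le.
Qed.

Section Powers.
Variable S : comNzRingType.
Implicit Types (I J : set S) (xs ys : seq S).

(** The ideal I + (xs)^n, computed by (x, J)^{n+1} = x (x, J)^n + J^{n+1} so
that both the number of generators and the exponent go down. *)
Fixpoint power_mod I xs : nat -> set S :=
  if xs is x :: xs' then
    fix powx n :=
      if n is n'.+1 then
        [set y | exists2 u, powx n' u & power_mod I xs' n (y - x * u)]
      else setT
  else fun n => if n is 0 then setT else I.

Lemma power_mod0 I xs : power_mod I xs 0 = setT. Proof. by case: xs. Qed.

Lemma power_mod_ideal I xs n : is_ideal I -> is_ideal (power_mod I xs n).
Proof.
move=> iI; elim: xs n => [|x xs IHx].
  by case=> [|n]; [exact: ideal_full | exact: iI].
elim=> [|n IHn]; first exact: ideal_full.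
have iP := IHx n.+1.
split=> [|u v [u' pu Iu] [v' pv Iv]|a u [u' pu Iu]].
- by exists 0; [exact: ideal0 IHn | rewrite mulr0 subr0; exact: ideal0].
- exists (u' + v'); first exact: (idealD IHn).
  by rewrite mulrDr opprD addrACA; exact: (idealD iP).
- exists (a * u'); first exact: (idealM _ IHn).
  by rewrite mulrCA -mulrBr; exact: (idealM _ iP).
Qed.

Lemma power_mod_tail I x xs n : is_ideal I ->
  power_mod I xs n `<=` power_mod I (x :: xs) n.
Proof.
move=> iI; case: n => [//|n] u pu; exists 0; last by rewrite mulr0 subr0.
exact: ideal0 (power_mod_ideal (x :: xs) n iI).
Qed.

Lemma power_mod_dec I xs n : is_ideal I ->
  power_mod I xs n.+1 `<=` power_mod I xs n.
Proof.
move=> iI; elim: xs n => [|x xs IHx]; first by case=> [|n] u.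
elim=> [//|n IHn] y [u pu py]; exists u; first exact: IHn.
exact: IHx.
Qed.

Lemma power_mod_base I xs n : is_ideal I -> I `<=` power_mod I xs n.
Proof.
move=> iI; elim: xs n => [|x xs IHx] n; first by case: n => [|n] u.
by apply: (subset_trans (IHx n)); exact: power_mod_tail.
Qed.

Lemma power_mod_mono I J xs n : I `<=` J ->
  power_mod I xs n `<=` power_mod J xs n.
Proof.
move=> IJ; elim: xs n => [|x xs IHx]; first by case=> [|n] u //; exact: IJ.
elim=> [//|n IHn] y [u pu py]; exists u; first exact: IHn.
exact: IHx.
Qed.

Lemma power_mod_mul I xs n x u : is_ideal I -> x \in xs -> power_mod I xs n u ->
  power_mod I xs n.+1 (x * u).
Proof.
move=> iI; elim: xs n u => [//|y xs IHx]; elim=> [|n IHn] u.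
  rewrite inE => /predU1P[->|xs_x] _.
    by exists u; rewrite // subrr; exact: ideal0 (power_mod_ideal _ _ iI).
  by apply: power_mod_tail => //; apply: IHx; rewrite // power_mod0.
rewrite inE => /predU1P[->|xs_x] pu.
  by exists u; rewrite // subrr; exact: ideal0 (power_mod_ideal _ _ iI).
have [v pv pu'] := pu; exists (x * v); first by apply: IHn;
  rewrite // inE xs_x orbT.
by rewrite mulrCA -mulrBr; exact: IHx.
Qed.

Lemma power_modS_sub I xs n : is_ideal I ->
  power_mod I xs n.+1 `<=` adjoins I xs.
Proof.
elim: xs I n => [|x xs IH] I n iI y; first by [].
case=> u _ py.
apply: (ideal_congr (adjoins_ideal _ (adjoin_ideal x iI)) _
  (idealMl u (adjoins_ideal _ (adjoin_ideal x iI)) _)).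
  apply: (adjoins_sub2 _ _ _ (IH I n iI _ py)) => //; first exact: adjoin_ideal.
  exact: adjoin_subl.
by apply: adjoins_subl; exact: adjoin_mem.
Qed.

Lemma power_mod_adjoin_sub I x xs n : is_ideal I ->
  power_mod (adjoin I x) xs n `<=` adjoin (power_mod I xs n) x.
Proof.
move=> iI; elim: xs n => [|z xs IHx]; first by case=> [|n] u pu //; exists 0.
elim=> [|n IHn] y; first by exists 0.
move=> [u /IHn[a pu] /IHx[b py]]; exists (z * a + b); exists (u - a * x) => //.
by have -> : y - (z * a + b) * x - z * (u - a * x) = y - z * u - b * x by ring.
Qed.

(** Modulo x, the powers of (x, xs) are those of (xs). *)
Lemma power_mod_adjoin I x xs n : is_ideal I ->
  adjoin (power_mod I (x :: xs) n.+1) x = power_mod (adjoin I x) xs n.+1.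
Proof.
move=> iI; have iIx := adjoin_ideal x iI.
have iP := power_mod_ideal xs n.+1 iIx.
have px : power_mod (adjoin I x) xs n.+1 x by apply: power_mod_base => //;
  exact: adjoin_mem.
apply/seteqP; split.
  apply: adjoin_sub => // y [u _ py]; apply: (ideal_congr iP).
    by apply: power_mod_mono py; exact: adjoin_subl.
  exact: idealMl.
move=> y /(power_mod_adjoin_sub iI)[a py]; exists a; exact: power_mod_tail.
Qed.

(** If x u = x v + w with v in (x, xs)^n and w in (xs)^{n+1}, then u - v is in
(xs)^{n+1}, provided that x is a nonzerodivisor modulo that ideal. *)
Lemma power_mod_colon_head I x xs n u :
  (forall v, power_mod I xs n.+1 (x * v) -> power_mod I xs n.+1 v) ->
  is_ideal I ->
  power_mod I (x :: xs) n.+1 (x * u) -> power_mod I (x :: xs) n u.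
Proof.
move=> col iI [v pv]; rewrite -mulrBr => /col puv.
apply: (ideal_congr (power_mod_ideal (x :: xs) n iI) _ pv).
by apply: power_mod_dec => //; exact: power_mod_tail.
Qed.

(** Let x be the head of xs and xs' its tail. Induction modulo x shows that an
annihilated u is x w modulo (xs')^n. Then x z w is in (xs)^n, so
[power_mod_colon_head] puts z w in (xs)^{n-1}, and induction on n applies. *)
Lemma power_mod_nzd I z xs n u : is_ideal I -> perm_regular I (z :: xs) ->
  power_mod I xs n (z * u) -> power_mod I xs n u.
Proof.
elim: xs I z n u => [|x xs IHx] I z n u iI rI.
  by case: n => [//|n]; exact: (perm_regular_nzd rI).
have rx := perm_regular_tail rI.
have rzx : perm_regular (adjoin I x) (z :: xs).
  move=> ys pys; have [] // : regular_mod I (x :: ys); apply: rI.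
  rewrite -(perm_cons x) in pys; apply: (perm_trans pys).
  by rewrite -(cat1s x (z :: xs)) -(cat1s z xs) perm_catCA.
elim: n u => [//|n IHn] u pzu.
have /(power_mod_adjoin_sub iI)[w uw] : power_mod (adjoin I x) xs n.+1 u.
  apply: (IHx _ z) => //; first exact: adjoin_ideal.
  by rewrite -power_mod_adjoin //; exact: adjoin_subl.
exists w; last by rewrite mulrC.
apply: IHn; apply: (@power_mod_colon_head I x xs) => //.
  by move=> v; apply: IHx.
have -> : x * (z * w) = z * u - z * (u - w * x) by ring.
apply: (idealB (power_mod_ideal _ _ iI) pzu);
  apply: (idealM _ (power_mod_ideal _ _ iI)).
exact: power_mod_tail.
Qed.

Lemma power_mod_colon I x xs n u : is_ideal I -> perm_regular I (x :: xs) ->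
  power_mod I (x :: xs) n.+1 (x * u) -> power_mod I (x :: xs) n u.
Proof.
by move=> iI rI; apply: power_mod_colon_head => // v; exact: power_mod_nzd.
Qed.

Lemma power_mod_colonX I x xs n k u : is_ideal I -> perm_regular I (x :: xs) ->
  power_mod I (x :: xs) (k + n) (x ^+ k * u) -> power_mod I (x :: xs) n u.
Proof.
move=> iI rI; elim: k u => [|k IH] u; first by rewrite mul1r.
by rewrite exprS -mulrA addSn => /(power_mod_colon iI rI)/IH.
Qed.

Section Length.
Variables (R : comNzRingType) (i : {rmorphism R -> S}).

(** With B_k the ideal generated by k of the elements, multiplication by x gives
l(S/B_{k+1}^{n+1}) = l(S/B_{k+1}^n) + l(S/((x) + B_k^{n+1})), which is Pascal's
rule. *)
Lemma colength_power_mod I xs n l : is_ideal I -> perm_regular I xs ->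
  colength i (adjoins I xs) l ->
  colength i (power_mod I xs n.+1) (l * 'C(n + size xs, size xs)).
Proof.
elim: xs I n => [|x xs IHx] I n iI rI lenI /=; first by rewrite bin0 muln1.
have colE k :
    [set u | power_mod I (x :: xs) k.+1 (x * u)] = power_mod I (x :: xs) k.
  apply/seteqP; split=> u; first exact: power_mod_colon.
  by move=> pu; apply: power_mod_mul; rewrite ?mem_head.
have lenx k : colength i (adjoin (power_mod I (x :: xs) k.+1) x)
    (l * 'C(k + size xs, size xs)).
  rewrite power_mod_adjoin //; apply: IHx lenI; first exact: adjoin_ideal.
  exact: perm_regular_adjoin.
rewrite addnS binS addnC mulnDr addnC.
elim: n => [|n IHn]; apply: colength_colon (lenx _); try exact: power_mod_ideal.
  by rewrite colE power_mod0 bin_small // muln0; exact: colength_full.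
by rewrite colE addSn binS mulnDr.
Qed.

End Length.
End Powers.

(** * Tight closure *)

Section Frobenius.
Variables (R : comNzRingType) (p : nat).
Hypotheses (charp : p \in [pchar R]).
Implicit Types (I J : set R) (xs ys : seq R).

Notation frob q := (map (fun x => x ^+ q)).

Lemma pchar_natX e : [pchar R].-nat (p ^ e)%N.
Proof. by rewrite pnatX pnatE ?charp //; exact: (pcharf_prime charp). Qed.
Lemma frobD e (x y : R) : (x + y) ^+ (p ^ e) = x ^+ (p ^ e) + y ^+ (p ^ e).
Proof. by rewrite exprDn_pchar // pchar_natX. Qed.
Lemma frobB e (x y : R) : (x - y) ^+ (p ^ e) = x ^+ (p ^ e) - y ^+ (p ^ e).
Proof. by rewrite frobD exprNn_pchar // pchar_natX. Qed.
Lemma frob_gt0 e : (0 < p ^ e)%N.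
Proof. by rewrite expn_gt0 prime_gt0 // (pcharf_prime charp). Qed.

Lemma frob_mem e xs y : ideal_seq xs y ->
  ideal_seq (frob (p ^ e) xs) (y ^+ (p ^ e)).
Proof.
have iF := ideal_seq_ideal (frob (p ^ e) xs).
move: y; apply: (@ideal_seq_sub _ xs [set y | ideal_seq _ (y ^+ (p ^ e))]).
  split=> [|x y Fx Fy|a x Fx] /=.
  - by rewrite expr0n eqn0Ngt frob_gt0; exact: (ideal0 iF).
  - by rewrite frobD; exact: (idealD iF).
  - by rewrite exprMn; exact: (idealM _ iF).
by move=> x xs_x; apply: ideal_seq_mem; exact: (map_f (fun x => x ^+ (p ^ e))).
Qed.

Lemma frobenius_powerE e xs :
  frobenius_power (ideal_seq xs) (p ^ e) = ideal_seq (frob (p ^ e) xs).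
Proof.
apply/seteqP; split=> y; last by exists xs.
case=> ys eqxy; apply: ideal_seq_sub => [|_ /mapP[x ys_x ->]].
  exact: ideal_seq_ideal.
by apply: frob_mem; rewrite eqxy; exact: ideal_seq_mem.
Qed.

Hypothesis noeth : noetherian R.

Lemma frobenius_power_colon e I J a y : is_ideal I -> is_ideal J ->
  (forall x, I x -> J (a * x)) -> frobenius_power I (p ^ e) y ->
  frobenius_power J (p ^ e) (a ^+ (p ^ e) * y).
Proof.
move=> /noeth[xs ->] /noeth[ys ->] IJ; rewrite !frobenius_powerE.
apply: (ideal_seq_sub (colon_ideal _ (ideal_seq_ideal _))).
move=> _ /mapP[x xs_x ->]; rewrite /= -exprMn; apply: frob_mem; apply: IJ;
  exact: ideal_seq_mem.
Qed.

(** The multiplier c is kept, and c (a u)^q = a^q (c u^q). *)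
Lemma tight_closure_colon I J a u : is_ideal I -> is_ideal J ->
  (forall x, I x -> J (a * x)) -> tight_closure p I u ->
    tight_closure p J (a * u).
Proof.
move=> iI iJ IJ [c cP [N cN]]; exists c => //; exists N => e /cN cu.
by rewrite exprMn mulrCA; exact: frobenius_power_colon cu.
Qed.

Lemma tight_closure_sub I J : is_ideal I -> is_ideal J -> I `<=` J ->
  tight_closure p I `<=` tight_closure p J.
Proof.
move=> iI iJ IJ u Iu; rewrite -[u]mul1r;
  apply: (tight_closure_colon iI) => // x Ix.
by rewrite mul1r; exact: IJ.
Qed.

Lemma tight_closure_mem I : is_ideal I -> I `<=` tight_closure p I.
Proof.
move=> /noeth[xs ->] u xsu; exists 1; first by move=> P [[_ nP1 _] _].
by exists 0%N => e _; rewrite mul1r frobenius_powerE; exact: frob_mem.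
Qed.

Lemma nzd_ring_circ (c : R) : nzd [set 0] c -> ring_circ c.
Proof.
move=> nc P [pP minP] Pc.
have s0P : [set 0] `<=` P by move=> _ ->; apply: ideal0; case: pP.
have [P0 [pP0 _ [P0P nPP0]]] :=
  nzd_not_minimal noeth (@ideal_zero R) nc pP s0P Pc.
by apply: nPP0; rewrite (minP P0).
Qed.

(** I is tightly closed; the other inclusion always holds. *)
Definition tclosed I := tight_closure p I `<=` I.

Section RegularParameters.
Variables (m : set R) (d : nat).
Hypotheses (loc : is_local_ring m)
  (regR : forall xs, size xs = d -> params m xs -> perm_regular [set 0] xs).

Lemma params_radical xs ys : params m xs -> (forall y, y \in ys -> m y) ->
  (forall x, x \in xs -> radical (ideal_seq ys) x) -> params m ys.
Proof.
move=> [_ prx] mys xsy; split=> // v mv; apply: contrapT => nv.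
have [P [pP ysP nPv]] := prime_above noeth (ideal_seq_ideal ys) nv.
apply: nPv; apply: (radical_prime pP _ (prx _ mv)).
by apply: ideal_seq_sub => [|x /xsy]; [case: pP | exact: radical_prime].
Qed.

(** This is what makes Frobenius compatible with regularity: the q-th powers of
a system of parameters are again one. *)
Lemma params_exp xs q : (0 < q)%N -> params m xs -> params m (frob q xs).
Proof.
case: q => // q _ pxs; have [mxs _] := pxs.
apply: (params_radical pxs) => [_ /mapP[x xs_x ->]|x xs_x].
  by rewrite exprS; apply: (idealMl _ (max_ideal loc)); exact: mxs.
by exists q.+1; apply: ideal_seq_mem; exact: (map_f (fun x => x ^+ q.+1)).
Qed.

Lemma params_exp_last xs x zs k : params m (xs ++ x :: zs) ->
  params m (xs ++ x ^+ k.+1 :: zs).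
Proof.
move=> pxs; have [mxs _] := pxs; apply: (params_radical pxs) => y.
  rewrite mem_cat inE => /or3P[ys|/eqP->|ys].
  - by apply: mxs; rewrite mem_cat ys.
  - rewrite exprS; apply: (idealMl _ (max_ideal loc)); apply: mxs.
    by rewrite mem_cat mem_head orbT.
  - by apply: mxs; rewrite mem_cat inE ys !orbT.
rewrite mem_cat inE => /or3P[ys|/eqP->|ys].
- by exists 1%N; apply: ideal_seq_mem; rewrite expr1 mem_cat ys.
- by exists k.+1; apply: ideal_seq_mem; rewrite mem_cat mem_head orbT.
- by exists 1%N; apply: ideal_seq_mem; rewrite expr1 mem_cat inE ys !orbT.
Qed.

Lemma params_nzd xs x : size (rcons xs x) = d -> params m (rcons xs x) ->
  nzd (ideal_seq xs) x.
Proof.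
move=> sz pxs; have /regular_mod_rcons[_] := regR sz pxs (perm_refl _).
by rewrite ideal_seqE.
Qed.

(** Induction on t. An element u of (xs, x^{t+2})^* is x w modulo (xs), and
cancelling x^q modulo (xs)^{[q]} shows that w is in (xs, x^{t+1})^*. *)
Lemma tclosed_pow xs x t : size (rcons xs x) = d -> params m (rcons xs x) ->
  tclosed (ideal_seq (rcons xs x)) ->
    tclosed (ideal_seq (rcons xs (x ^+ t.+1))).
Proof.
move=> sz pxs cx; have is_ := ideal_seq_ideal.
elim: t => [//|t IH] u tu.
have /cx : tight_closure p (ideal_seq (rcons xs x)) u.
  apply: tight_closure_sub tu => //; rewrite !ideal_seq_rcons.
  apply: adjoin_sub; [exact: adjoin_ideal | exact: adjoin_subl |].
  by rewrite exprSr; apply: idealM; [exact: adjoin_ideal | exact: adjoin_mem].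
rewrite ideal_seq_rcons => -[w xsu].
have /IH : tight_closure p (ideal_seq (rcons xs (x ^+ t.+1))) w.
  have [c cP [N cN]] := tu; exists c => //; exists N => e /cN.
  rewrite !frobenius_powerE !map_rcons !ideal_seq_rcons => -[r cr].
  have iF := is_ _ (frob (p ^ e) xs).
  exists r; apply: (@params_nzd (frob (p ^ e) xs) (x ^+ (p ^ e))).
  - by rewrite -(map_rcons (fun x => x ^+ (p ^ e))) size_map.
  - by rewrite -(map_rcons (fun x => x ^+ (p ^ e))); apply: params_exp => //;
    exact: frob_gt0.
  have := @frob_mem e _ _ xsu; rewrite frobB exprMn => xsu'.
  have -> : x ^+ (p ^ e) * (c * w ^+ (p ^ e) - r * x ^+ t.+1 ^+ (p ^ e)) =
      (c * u ^+ (p ^ e) - r * x ^+ t.+2 ^+ (p ^ e))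
      - c * (u ^+ (p ^ e) - w ^+ (p ^ e) * x ^+ (p ^ e)).
    by rewrite [x ^+ t.+2]exprS exprMn; ring.
  by apply: (idealB iF cr); exact: (idealM _ iF).
rewrite !ideal_seq_rcons => -[b xsw]; exists b.
have -> : u - b * x ^+ t.+2 = (u - w * x) + x * (w - b * x ^+ t.+1).
  by rewrite [x ^+ t.+2]exprS; ring.
by apply: (idealD (is_ _ xs) xsu); exact: (idealM _ (is_ _ xs)).
Qed.

(** Write x^{k+1} = a y modulo (xs). Multiplication by a maps (xs, y)^* into
(xs, x^{k+1})^*, which is (xs, x^{k+1}), and a is a nonzerodivisor modulo (xs).
*)
Lemma tclosed_swap xs x y : size (rcons xs x) = d -> params m (rcons xs x) ->
  params m (rcons xs y) -> tclosed (ideal_seq (rcons xs x)) ->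
  tclosed (ideal_seq (rcons xs y)).
Proof.
move=> sz px py cx; have is_ := ideal_seq_ideal.
have [k [a xsa]] : exists k, adjoin (ideal_seq xs) y (x ^+ k.+1).
  have [k] : radical (ideal_seq (rcons xs y)) x.
    by apply: py.2; apply: px.1; rewrite mem_rcons mem_head.
  by move=> xk; exists k; rewrite -ideal_seq_rcons exprS;
    exact: (idealM _ (is_ _ _)).
have ck := tclosed_pow (t := k) sz px cx.
have nxk := nzdX (k := k.+1) (params_nzd sz px).
move=> u tu.
have /ck : tight_closure p (ideal_seq (rcons xs (x ^+ k.+1))) (a * u).
  apply: tight_closure_colon tu => //.
  apply: (ideal_seq_sub (colon_ideal _ (is_ _ _))) => z.
  rewrite /= mem_rcons inE ideal_seq_rcons => /predU1P[->|xs_z].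
    exists 1; rewrite mul1r.
    have -> : a * y - x ^+ k.+1 = - (x ^+ k.+1 - a * y) by ring.
    exact: (idealN (is_ _ xs)).
  by apply: adjoin_subl; apply: (idealM _ (is_ _ xs)); exact: ideal_seq_mem.
rewrite !ideal_seq_rcons => -[r xsr]; exists r; apply: nxk.
have -> : x ^+ k.+1 * (u - r * y) =
    (x ^+ k.+1 - a * y) * (u - r * y) + y * (a * u - r * x ^+ k.+1)
     + y * r * (x ^+ k.+1 - a * y) by ring.
have ixs := is_ _ xs; apply: (idealD ixs); last exact: (idealM _ ixs).
by apply: (idealD ixs); [exact: (idealMl _ ixs) | exact: (idealM _ ixs)].
Qed.

Lemma tclosed_params xs ys : size xs = d -> size ys = d -> params m xs ->
  params m ys -> tclosed (ideal_seq xs) -> tclosed (ideal_seq ys).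
Proof.
move=> szx szy pxs pys cxs.
suff [] : size ys = d /\ tclosed (ideal_seq ys) by [].
apply: (params_connected noeth loc
  (T := fun zs => size zs = d /\ tclosed (ideal_seq zs))) (conj szx cxs) => //.
- move=> us vs puv _ [szu cu]; rewrite -(perm_size puv); split=> //.
  by rewrite (@ideal_seqC _ vs us) // => z; rewrite (perm_mem puv).
- move=> zs x y px py [sz cx]; split; first by rewrite -sz !size_rcons.
  exact: tclosed_swap cx.
- by rewrite szx.
Qed.

(** The tight closure of (xs) lies in the intersection K of the (xs, x^{t+1}),
and K = (xs) by Nakayama because K is inside (xs) + xK. *)
Lemma tclosed_drop xs x : m x -> nzd (ideal_seq xs) x ->
  (forall t, tclosed (ideal_seq (rcons xs (x ^+ t.+1)))) ->
    tclosed (ideal_seq xs).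
Proof.
move=> mx nx cx u tu; have is_ := ideal_seq_ideal.
pose K := [set v | forall t, ideal_seq (rcons xs (x ^+ t.+1)) v].
have iK : is_ideal K.
  split=> [t|v w Kv Kw t|a v Kv t]; first exact: (ideal0 (is_ _ _)).
  - exact: (idealD (is_ _ _) (Kv t) (Kw t)).
  - exact: (idealM _ (is_ _ _) (Kv t)).
suff KI : K `<=` ideal_seq xs.
  apply: KI => t; apply: cx; apply: tight_closure_sub tu => //.
  by rewrite ideal_seq_rcons; exact: adjoin_subl.
apply: (nakayama_ideal noeth loc (is_ _ xs) iK mx) => {tu}u Ku.
have := Ku 0%N; rewrite ideal_seq_rcons => -[v xsv]; exists v;
  last by rewrite mulrC.
move=> t; have := Ku t.+1; rewrite !ideal_seq_rcons => -[r xsr]; exists r;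
  apply: nx.
have -> : x * (v - r * x ^+ t.+1) = (u - r * x ^+ t.+2) - (u - v * x ^+ 1).
  by rewrite [x ^+ t.+2]exprS; ring.
exact: (idealB (is_ _ xs)).
Qed.

Lemma tclosed_partial xs zs : (size xs + size zs)%N = d ->
  params m (xs ++ zs) ->
  (forall ys, size ys = d -> params m ys -> tclosed (ideal_seq ys)) ->
  tclosed (ideal_seq xs).
Proof.
move=> szd pxz call; elim: zs xs szd pxz => [|z zs IH] xs szd pxz.
  by apply: call; rewrite ?cats0 // in pxz *; rewrite -szd addn0.
have szd' w : (size (rcons xs w) + size zs)%N = d.
  by rewrite size_rcons -szd addnS.
apply: (@tclosed_drop _ z).
- by apply: pxz.1; rewrite mem_cat mem_head orbT.
- have /regular_mod_cat[_ []] : regular_mod [set 0] (xs ++ z :: zs).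
    by apply: (regR _ pxz (perm_refl _)); rewrite size_cat.
  by rewrite -ideal_seqE.
- move=> t; apply: IH; first exact: szd'.
  by rewrite cat_rcons; exact: params_exp_last.
Qed.

End RegularParameters.
End Frobenius.

(** * Leading coefficients of length functions *)

Section Asymptotics.

(** For x >= 1, the terms of degree less than k add up to at most C x^k / x,
which a negative term of degree k would eventually outweigh. *)
Lemma coef_ge0_eventually (h : {poly rat}) k N0 : (size h <= k.+1)%N ->
  (forall N, (N0 <= N)%N -> 0 <= h.[N%:R]) -> 0 <= h`_k.
Proof.
move=> szh h_ge0; rewrite leNgt; apply/negP => hk_lt0.
pose C := \sum_(l < k) `|h`_l|.
have C_ge0 : 0 <= C by apply: sumr_ge0.
have bound N : (0 < N)%N -> (N0 <= N)%N -> 0 <= C + h`_k * N%:R.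
  move=> N_gt0 leN; have x_gt0 : 0 < N%:R :> rat by rewrite ltr0n.
  have x_ge1 : 1 <= N%:R :> rat by rewrite ler1n.
  have := h_ge0 N leN; rewrite (horner_coef_wide _ szh) big_ord_recr /= => hN.
  rewrite -(pmulr_lge0 _ (exprn_gt0 k x_gt0)) mulrDl -mulrA -exprS.
  pose hNk := \sum_(l < k) h`_l * N%:R ^+ l + h`_k * N%:R ^+ k.
  apply: (@le_trans _ _ (N%:R * hNk)).
    by apply: mulr_ge0 => //; exact: ltW.
  rewrite /hNk mulrDr mulrCA -exprS lerD2r mulr_sumr mulr_suml.
  apply: ler_sum => l _; rewrite mulrCA -exprS.
  apply: (@le_trans _ _ (`|h`_l| * N%:R ^+ l.+1)).
    by apply: ler_wpM2r; [exact: exprn_ge0 (ltW x_gt0) | exact: ler_norm].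
  by apply: ler_wpM2l => //; exact: ler_weXn2l.
have b_ge0 : 0 <= C / - h`_k by rewrite divr_ge0 // oppr_ge0 ltW.
pose N := (Num.bound (C / - h`_k) + N0).+1.
have := bound N isT (leq_trans (leq_addl _ _) (leqnSn _)).
have : C / - h`_k < N%:R.
  apply: (lt_le_trans (archi_boundP b_ge0)).
  by rewrite ler_nat; apply: (leq_trans (leq_addr _ _) (leqnSn _)).
rewrite ltr_pdivrMr ?oppr_gt0 // => ltC; lra.
Qed.

Lemma expn_leq_ffact N d : (N ^ d <= (N + d) ^_ d)%N.
Proof.
elim: d => [//|d IH]; rewrite addnS ffactSS expnS leq_mul //.
by rewrite (leq_trans (leq_addr d N)).
Qed.

(** Compare terms of degree d, using N^d <= d! C(N+d, d). *)
Lemma leading_term_le d l e0 N0 (f g : {poly rat}) :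
  size f = d.+1 -> e0%:R = (d`!)%:R * lead_coef f -> (size g <= d)%N ->
  (forall N, (N0 <= N)%N -> (l * 'C(N + d, d))%:R <= f.[N%:R] + g.[N%:R]) ->
  (l <= e0)%N.
Proof.
move=> szf e0f szg fg.
pose h := (d`!)%:R *: (f + g) - l%:R *: 'X^d.
have hd : h`_d = e0%:R - l%:R.
  rewrite coefB !coefZ coefD coefXn eqxx mulr1 [g`_d]nth_default // addr0.
  by rewrite e0f lead_coefE szf.
rewrite -(ler_nat rat) -subr_ge0 -hd; apply: (@coef_ge0_eventually _ _ N0).
  rewrite (leq_trans (size_polyD _ _)) // size_polyN geq_max.
  rewrite !(leq_trans (size_scale_leq _ _)) ?size_polyXn //.
  by rewrite (leq_trans (size_polyD _ _)) // szf geq_max leqnn leqW.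
move=> N leN; rewrite hornerD hornerN !hornerZ hornerXn hornerD subr_ge0.
apply: (@le_trans _ _ ((d`!)%:R * (l * 'C(N + d, d))%:R)); last first.
  by apply: ler_wpM2l; [exact: ler0n | exact: fg].
rewrite -natrX -!natrM ler_nat mulnCA leq_mul2l; apply/orP; right.
by rewrite mulnC bin_ffact expn_leq_ffact.
Qed.

End Asymptotics.

(** * Finite extensions *)

Section FiniteExtension.
Variables (R S : comNzRingType) (i : {rmorphism R -> S}).
Variables (m : set R) (n : set S).
Hypotheses (noeth : noetherian R) (loc : is_local_ring m).
Hypotheses (noethS : noetherian S) (locS : is_local_ring n).
Hypotheses (fin : module_finite i).
Implicit Types (xs : seq R) (N : set S).

(** If the image of r were a unit of S, then S = rS would be 0 by Nakayama. *)
Lemma max_image r : m r -> n (i r).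
Proof.
move=> mr; apply: contrapT => /(local_unit noethS locS)[v vr].
have sub_0 : is_sub i [set 0] by exact: (ideal_sub i (@ideal_zero S)).
have : [set 0] = setT :> set S.
  apply: (nakayama_finite noeth loc (xs := [:: r]) fin sub_0) => [x|u].
    by rewrite inE => /eqP->.
  exists u; last by rewrite /= subrr.
  rewrite -[u]mulr1 -vr; do 2!apply: (idealM _ (ideal_seq_ideal _)).
  by apply: ideal_seq_mem; rewrite mem_head.
move/seteqP => [_ /(_ 1 I)] /= /eqP; by rewrite oner_eq0.
Qed.

(** S/(xs)S has finite length over R, so the ideals (xs) + (u^k) become
stationary: u^k = a u^{k+1} modulo (xs), where 1 - a u is a unit of S. *)
Lemma params_image xs : params m xs -> params n [seq i x | x <- xs].
Proof.
move=> [mxs prx]; split=> [_ /mapP[x xs_x ->]|u nu].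
  by apply: max_image; exact: mxs.
set N := ideal_seq _; have iN : is_ideal N by exact: ideal_seq_ideal.
have [l bl] : exists l, colength_le i N l.
  apply: (finite_length noeth loc) => //; apply: (subset_trans prx).
  apply: radical_sub; apply: ideal_seq_sub; first exact: preimage_ideal.
  by move=> x xs_x; apply: ideal_seq_mem; exact: map_f.
have iD k := adjoin_ideal (u ^+ k) iN.
have [k] : exists k, adjoin N (u ^+ k) `<=` adjoin N (u ^+ k.+1).
  apply: (colength_le_stable bl) => k;
    [exact: ideal_sub | exact: adjoin_subl |].
  apply: adjoin_sub => //; first exact: adjoin_subl.
  by rewrite exprS; apply: idealM => //; exact: adjoin_mem.
move/(_ _ (adjoin_mem _ iN)) => [a Nk]; exists k.
have [|v v1] := @unit_sub1 _ _ noethS locS (a * u);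
  first exact: (idealM _ (max_ideal locS)).
have -> : u ^+ k = v * (u ^+ k - a * u ^+ k.+1).
  by rewrite -{1}[u ^+ k]mul1r -v1 exprS; ring.
exact: (idealM _ iN).
Qed.

Lemma ideal_pow_image xs k :
  ideal_pow (ideal_seq xs) k `<=`
    i @^-1` (power_mod [set 0] [seq i x | x <- xs] k).
Proof.
elim: k => [|k IH]; first by rewrite power_mod0.
have iP := power_mod_ideal [seq i x | x <- xs] k.+1 (@ideal_zero S).
apply: ideal_gen_sub; first exact: preimage_ideal.
move=> _ [x [y [xs_x /IH py ->]]] /=; rewrite rmorphM mulrC.
apply: (@ideal_seq_sub _ xs [set x | power_mod _ _ k.+1 (i y * i x)]) xs_x.
  exact: (preimage_ideal i (colon_ideal (i y) iP)).
move=> z xs_z; rewrite /= mulrC.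
by apply: power_mod_mul => //; [exact: ideal_zero | exact: map_f].
Qed.

(** Brings the elements of Q^{n+1}S into the form that [extension_tight_closure]
requires. *)
Lemma power_mod_sub_extension xs J k : (forall x, x \in xs -> J x) ->
  power_mod [set 0] [seq i x | x <- xs] k `<=` ideal_gen (i @` ideal_pow J k).
Proof.
elim: xs k => [|x xs IHx] k xsJ.
  case: k => [|k] u pu; last by rewrite pu; exact: ideal0 (ideal_gen_ideal _).
  rewrite -[u]mulr1; apply: (idealM _ (ideal_gen_ideal _));
    apply: ideal_gen_mem.
  by exists 1 => //; exact: rmorph1.
elim: k => [|k IHk] u pu.
  rewrite -[u]mulr1; apply: (idealM _ (ideal_gen_ideal _));
    apply: ideal_gen_mem.
  by exists 1 => //; exact: rmorph1.
have [v /IHk Jv /IHx Juv] := pu.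
apply: (ideal_congr (ideal_gen_ideal _) (Juv _)).
  by move=> y xs_y; apply: xsJ; rewrite inE xs_y orbT.
apply: (@ideal_gen_sub _ _ [set v | ideal_gen _ (i x * v)] _ _ v Jv).
  exact: (colon_ideal _ (ideal_gen_ideal _)).
move=> _ [y Jy <-] /=; rewrite -rmorphM; apply: ideal_gen_mem.
by exists (x * y) => //; apply: ideal_powS => //; apply: xsJ; rewrite mem_head.
Qed.

Section Conductor.
Variables (c : R).
Hypotheses (nc : nzd [set 0] c) (cS : forall u, exists r, i r = i c * u).

(** From z = sum z_j b_j with z_j in K and b_j in S, c z^q = sum z_j^q (c
b_j^q), where each c b_j^q is in R. *)
Lemma extension_tight_closure p K z : p \in [pchar R] -> injective i ->
  is_ideal K -> ideal_gen (i @` K) (i z) -> tight_closure p K z.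
Proof.
move=> charp i_inj iK Kz; exists c; first exact: nzd_ring_circ.
exists 0%N => e _; have [zs Kzs] := noeth iK.
rewrite Kzs (frobenius_powerE charp); set F := ideal_seq _.
have iF : is_ideal F by exact: ideal_seq_ideal.
have charpS : p \in [pchar S] by exact: (rmorph_pchar i).
(* Quantifying over b makes this set of v an ideal of S. *)
have Kext : ideal_gen (i @` K) `<=`
    [set v | forall b, exists2 r, F r & i r = i c * b * v ^+ (p ^ e)].
  apply: ideal_gen_sub.
    split=> [b|u v Fu Fv b|a u Fu b].
    - exists 0; first exact: (ideal0 iF).
      by rewrite expr0n eqn0Ngt (frob_gt0 charp) rmorph0 mulr0.
    - have [r Fr rE] := Fu b; have [t Ft tE] := Fv b.
      exists (r + t); first exact: (idealD iF).
      by rewrite rmorphD rE tE (frobD charpS) mulrDr.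
    - have [r Fr rE] := Fu (b * a ^+ (p ^ e)); exists r => //.
      by rewrite rE exprMn !mulrA.
  move=> _ [y Ky <-] b; have [r rE] := cS b; exists (r * y ^+ (p ^ e)).
    by apply: (idealM _ iF); apply: frob_mem => //; rewrite -Kzs.
  by rewrite rmorphM rmorphXn rE.
have [r Fr rE] := Kext _ Kz 1.
suff <- : r = c * z ^+ (p ^ e) by [].
by apply: i_inj; rewrite rE mulr1 rmorphM rmorphXn.
Qed.

(** If c is a unit, then S = R. Otherwise c extends to a system of parameters
(c, ys) of R, and y^a is in Q for each of the d - 1 elements y of ys. Then R +
Q^{k+1}S contains cS and all y^{a(k+1)}, so the length of the cokernel is at
most (a(k+1))^{d-1} l(S/(c, ys)S). *)
Lemma cokernel_bound d (s : seq R) : dim_le [set 0 : R] d -> size s = d ->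
  params m s ->
  exists2 g : {poly rat}, (size g <= d)%N & forall k, exists2 b,
    colength_le i
      (sum_image i (power_mod [set 0] [seq i x | x <- s] k.+1) setT) b
    & b%:R <= g.[k%:R].
Proof.
move=> dR szs ps; have i0 := @ideal_zero R; have i0S := @ideal_zero S.
have iP k := power_mod_ideal [seq i x | x <- s] k i0S.
have [mc|/(local_unit noeth loc)[v vc]] := pselect (m c); last first.
  exists 0 => [|k]; first by rewrite size_poly0.
  exists 0%N; last by rewrite horner0.
  suff -> : sum_image i (power_mod [set 0] [seq i x | x <- s] k.+1) setT = setT.
    exact: colength_le_full.
  apply/seteqP; split=> // u _; have [r ru] := cS u; exists (v * r) => //.
  by rewrite rmorphM ru mulrA -rmorphM vc rmorph1 mul1r subrr; exact: ideal0.
case: d => [|d] in dR szs *.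
  have s0m : [set 0] `<=` m by move=> _ ->; exact: ideal0 (max_ideal loc).
  have [P [pP _ Pm]] :=
    nzd_not_minimal noeth i0 nc (max_prime noeth loc) s0m mc.
  suff: (1 <= 0)%N by [].
  apply: (dR P) => //; first by move=> _ ->; apply: ideal0; case: pP.
  by exists m; split=> //; exact: max_prime.
have [ys [szy mys pry]] := extend_to_primary noeth loc (adjoin_ideal c i0)
  (dim_le_nzd noeth loc i0 nc dR).
have [a aQ] : exists a, forall y, y \in ys -> ideal_seq s (y ^+ a).
  apply: radical_uniform_exp; first exact: ideal_seq_ideal.
  by move=> y /mys; exact: ps.2.
have [l bl] : exists l,
    colength_le i (adjoins [set 0] [seq i x | x <- c :: ys]) l.
  have iA := adjoins_ideal [seq i x | x <- c :: ys] i0S.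
  apply: (finite_length noeth loc) => //; apply: (subset_trans pry).
  apply: radical_sub; apply: adjoins_sub; first exact: preimage_ideal.
    apply: adjoin_sub; first exact: preimage_ideal.
      by move=> _ ->; rewrite /= rmorph0; exact: ideal0.
    by apply: adjoins_mem => //; rewrite mem_head.
  by move=> y ys_y; apply: adjoins_mem => //; rewrite inE map_f // orbT.
exists ((l%:R)%:P * (a%:R *: ('X + 1)) ^+ d) => [|k].
  have szX : (size (a%:R *: ('X + 1) : {poly rat}) <= 2)%N.
    by rewrite (leq_trans (size_scale_leq _ _)) // size_XaddC.
  rewrite mul_polyC (leq_trans (size_scale_leq _ _)) //.
  rewrite (leq_trans (size_poly_exp_leq _ _)) // ltnS.
  by rewrite -[leqRHS]mul1n leq_mul2r orbC -subn1 leq_subLR szX.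
exists ((a * k.+1) ^ d * l)%N; last first.
  rewrite hornerM hornerC horner_exp hornerZ hornerD hornerX hornerC.
  by rewrite natrM natrX natrM mulrC -addn1 natrD.
set P := power_mod [set 0] [seq i x | x <- s] k.+1.
apply: (@colength_le_sub _ _ _ (adjoin P (i c))).
  move=> w [u pu]; have [r ru] := cS u; exists r => //.
  by rewrite ru mulrC.
have iPk : is_ideal P by exact: iP.
have iA := adjoin_ideal (i c) iPk.
rewrite -szy -(size_map i); apply: colength_le_pows => //.
  move=> _ /mapP[y ys_y ->]; apply: adjoin_subl.
  rewrite -rmorphXn; apply: ideal_pow_image; rewrite exprM.
  elim: k.+1 => [//|k' IH]; rewrite exprS; apply: ideal_powS => //; exact: aQ.
apply: colength_le_sub bl;
  apply: (@adjoins_sub2 _ (adjoin [set 0] (i c))) => //.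
apply: adjoin_sub => //; last exact: adjoin_mem.
by move=> _ ->; exact: (ideal0 iA).
Qed.

End Conductor.
End FiniteExtension.

Lemma common_denominator (R K S : comNzRingType) (iota : {rmorphism R -> K})
    (i : {rmorphism R -> S}) (j : {rmorphism S -> K}) :
  is_total_quotient_ring iota -> injective j -> (forall r, j (i r) = iota r) ->
  module_finite i ->
  exists2 c, nzd [set 0] c & forall u, exists r, i r = i c * u.
Proof.
move=> [_ _ frac] j_inj ji [gs gsP].
have den g : exists2 c, nzd [set 0] c & exists r, i r = i c * g.
  have [a [b [nb jgb]]] := frac (j g); exists b => //; exists a.
  by apply: j_inj; rewrite ji rmorphM ji -jgb mulrC.
have {den} [c nc cgs] : exists2 c, nzd [set 0] c &
    forall g, g \in gs -> exists r, i r = i c * g.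
  elim: (gs) => [|g hs [c nc chs]]; first by exists 1 => // u; rewrite /= mul1r.
  have [b nb [r rE]] := den g; exists (b * c).
    by move=> u; rewrite -mulrA => /nb/nc.
  move=> h; rewrite inE => /predU1P[->|/chs[t tE]].
    by exists (c * r); rewrite !rmorphM rE; ring.
  by exists (b * t); rewrite !rmorphM tE mulrA.
exists c => // u; have [a ->] := gsP u.
pose D := [set v | exists r, i r = i c * v].
have sD : is_sub i D.
  split=> [|v w [r rE] [t tE]|a' v [r rE]].
  - by exists 0; rewrite rmorph0 mulr0.
  - by exists (r + t); rewrite rmorphD rE tE mulrDr.
  - by exists (a' * r); rewrite rmorphM rE mulrCA.
apply: (sub_sum sD) => k; apply: (subZ _ sD); apply: cgs; exact: mem_nth.
Qed.

Section Isomorphism.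
Variables (R S : comNzRingType) (i : {rmorphism R -> S}).
Hypotheses (i_inj : injective i) (i_surj : forall u, exists r, i r = u).
Implicit Types (xs : seq R) (J : set S).

Lemma preimage_adjoin J x : i @^-1` adjoin J (i x) = adjoin (i @^-1` J) x.
Proof.
apply/seteqP; split=> y [a]; last by exists (i a); rewrite -rmorphM -rmorphB.
by have [b <-] := i_surj a; rewrite -rmorphM -rmorphB; exists b.
Qed.

Lemma regular_mod_preimage J xs : regular_mod J [seq i x | x <- xs] ->
  regular_mod (i @^-1` J) xs.
Proof.
elim: xs J => [//|x xs IH] J /= [nx /IH rx]; rewrite -preimage_adjoin;
  split=> //.
by move=> u; rewrite /= rmorphM => /nx.
Qed.

Lemma preimage_zero : i @^-1` [set 0] = [set 0].
Proof.
apply/seteqP; split=> x /=; last by move=> ->; exact: rmorph0.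
by rewrite -(rmorph0 i) => /i_inj.
Qed.

Lemma perm_regular_preimage xs : perm_regular [set 0] [seq i x | x <- xs] ->
  perm_regular [set 0] xs.
Proof.
by move=> rxs ys pys; rewrite -preimage_zero; apply: regular_mod_preimage;
  apply: rxs; exact: perm_map.
Qed.

Lemma preimage_adjoins xs :
  i @^-1` adjoins [set 0] [seq i x | x <- xs] = ideal_seq xs.
Proof.
rewrite ideal_seqE -preimage_zero; elim: xs [set 0] => [//|x xs IH] J /=.
by rewrite IH preimage_adjoin.
Qed.

End Isomorphism.

(** * The equality R = S and F-rationality *)

Theorem theorem1p5
    (R : comNzRingType) (m : set R) (d p : nat)
    (R_noeth : noetherian R) (R_local : is_local_ring m)
    (R_dim : krull_dim R d) (R_char : p \in [pchar R])
    (* K is Q(R), and R --i--> S --j--> K are the inclusions *)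
    (K : comNzRingType) (iota : {rmorphism R -> K})
    (K_tqr : is_total_quotient_ring iota)
    (S : comNzRingType) (i : {rmorphism R -> S}) (j : {rmorphism S -> K})
    (j_inj : injective j) (ji : forall r : R, j (i r) = iota r)
    (n_S : set S) (S_CM : cohen_macaulay_local n_S) (S_dim : krull_dim S d)
    (S_fin : module_finite i)
    (s : seq R) (s_sop : system_of_parameters m d s)
    (Q : set R) (Q_def : Q = ideal_seq s)
    (e0 : nat) (Q_mult : multiplicity d Q e0)
    (n : nat)
    (len_eq : quotient_length (tight_closure p (ideal_pow Q n.+1))
                              (e0 * 'C(n + d, d))%N) :
  range iota = range j /\ F_rational R p.
Proof.
have [S_noeth S_local _] := S_CM.
have i_inj : injective i.
  by move=> x y ixy; case: K_tqr => inj _ _; apply: inj; rewrite -!ji ixy.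
have [c nc cS] := common_denominator K_tqr j_inj ji S_fin.
have [szs rads] := s_sop.
have ps : params m s.
  split=> [x s_x|]; rewrite -?rads //.
  by exists 1%N; rewrite expr1; exact: ideal_seq_mem.
have i0S := @ideal_zero S.
pose P k := power_mod [set 0] [seq i x | x <- s] k.
have iP k : is_ideal (P k) by exact: power_mod_ideal.
have sP k : is_sub i (P k) by exact: ideal_sub.
have regS xs : size xs = d -> params m xs ->
    perm_regular [set 0] [seq i x | x <- xs].
  move=> szx pxs; apply: (cohen_macaulay_regular S_CM S_dim).
    by rewrite size_map.
  exact: (params_image R_noeth R_local S_noeth S_local S_fin).
have [l lenl] : exists l, colength i (adjoins [set 0] [seq i x | x <- s]) l.
  have [b bb] : exists b, colength_le i (adjoins [set 0] [seq i x | x <- s]) b.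
    apply: (finite_length R_noeth R_local S_fin); first exact: adjoins_ideal.
    apply: (subset_trans ps.2); apply: radical_sub; apply: ideal_seq_sub.
      by apply: preimage_ideal; exact: adjoins_ideal.
    by move=> x s_x; apply: adjoins_mem => //; exact: map_f.
  by have [l] := colength_exists bb; exists l.
have lenP k : colength i (P k.+1) (l * 'C(k + d, d)).
  by have := colength_power_mod k i0S (regS s szs ps) lenl;
    rewrite size_map szs.
have iD x y : i (x + y) = i x + i y by exact: rmorphD.
have iZ a x : i (idfun a * x) = i a * i x by exact: rmorphM.
(* Leading terms in l(S/Q^{N+1}S) <= l(R/Q^{N+1}) + l(S/(R + Q^{N+1}S)). *)
have le_e0 : (l <= e0)%N.
  have [f [[N0 fN] szf e0f]] := Q_mult.
  have [g szg gN] :=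
    cokernel_bound R_noeth R_local S_fin nc cS (krull_dim_le R_dim) szs ps.
  apply: (leading_term_le szf e0f szg (N0 := N0)) => N leN.
  have [lN lenN ->] := fN N leN; have [b bb bg] := gN N.
  apply: (@le_trans _ _ (lN + b)%:R); last by rewrite natrD lerD2l.
  rewrite ler_nat; case: (lenP N) => chP _; move: chP;
    apply: (colength_le_add iD iZ (sP _)) => //.
  apply: (colength_le_sub _ (quotient_length_bound (ideal_pow_ideal _ _) lenN)).
  by rewrite Q_def; exact: ideal_pow_image.
have Ptight : i @^-1` P n.+1 `<=` tight_closure p (ideal_pow Q n.+1).
  move=> x Px; apply: (extension_tight_closure R_noeth nc cS R_char i_inj).
    exact: ideal_pow_ideal.
  by apply: (power_mod_sub_extension _ Px) => y s_y; rewrite Q_def;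
    exact: ideal_seq_mem.
have [J [iJ tJ chJ]] := quotient_length_chain len_eq.
have bP a b : ascends (is_sub idfun) (i @^-1` P n.+1) a ->
    ascends (is_sub i) (sum_image i (P n.+1) setT) b ->
      (a + b <= e0 * 'C(n + d, d))%N.
  move=> cha chb; apply: (@leq_trans (l * 'C(n + d, d)));
    last by rewrite leq_mul2r le_e0 orbT.
  by apply: (lenP n).2; exact: (ascends_join iD iZ).
have PJ : i @^-1` P n.+1 `<=` J by exact: subset_trans tJ.
(* J already accounts for e0 * C(n+d, d), so R + Q^{n+1}S is all of S. *)
have i_surj u : exists r, i r = u.
  have im_full : sum_image i (P n.+1) setT = setT.
    apply: (colength0_full (i := i)) => b chb.
    by have := bP _ b (ascends_below PJ chJ) chb;
      rewrite -[leqRHS]addn0 leq_add2l.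
  have sim : is_sub i (range i).
    split=> [|_ _ [x _ <-] [y _ <-]|a _ [x _ <-]].
    - by exists 0 => //; exact: rmorph0.
    - by exists (x + y) => //; exact: rmorphD.
    - by exists (a * x) => //; exact: rmorphM.
  suff /seteqP[_ /(_ u I)[r _ <-]] : range i = setT by exists r.
  apply: (nakayama_finite R_noeth R_local (xs := s) S_fin sim ps.1) => v.
  have [r _ Pr] : sum_image i (P n.+1) setT v by rewrite im_full.
  exists (v - i r); last by exists r; rewrite // subKr.
  by rewrite ideal_seqE; exact: power_modS_sub Pr.
split.
  apply/seteqP; split=> [_ [r _ <-]|_ [u _ <-]]; first by exists (i r).
  by have [r <-] := i_surj u; exists r.
(* An element of the tight closure outside Q^{n+1}S would put J strictly above
   its contraction, making the chain above J one step too long. *)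
have tightP : tight_closure p (ideal_pow Q n.+1) `<=` i @^-1` P n.+1.
  move=> x tx; apply: contrapT => nPx.
  have := bP (e0 * 'C(n + d, d)).+1 0%N; rewrite addn0 ltnn => bP1.
  suff: false by []; apply: bP1 => //; exists J; split; first exact: ideal_sub.
    by split=> // JP; apply: nPx; apply: JP; exact: tJ.
  by [].
have regR xs : size xs = d -> params m xs -> perm_regular [set 0] xs.
  by move=> szx pxs; apply: (perm_regular_preimage i_inj i_surj); exact: regS.
have closedQ : tclosed p (ideal_seq s).
  move=> u tu; rewrite -(preimage_adjoins i_inj i_surj).
  have [s0|[x [s' sE]]] : s = [::] \/ exists x s', s = x :: s'.
    by case: (s) => [|x s']; [left | right; exists x, s'].
    (* Here d = 0, and Q = Q^{n+1} = 0: there is no x to multiply by. *)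
    apply: (@power_modS_sub _ _ _ n) => //; apply: tightP.
    apply: (tight_closure_sub R_char R_noeth _ _ _ tu);
      first exact: ideal_seq_ideal.
      exact: ideal_pow_ideal.
    by rewrite s0; apply: ideal_seq_sub; first exact: ideal_pow_ideal.
  have s_x : x \in s by rewrite sE mem_head.
  have /tightP : tight_closure p (ideal_pow Q n.+1) (x ^+ n * u).
    apply: (tight_closure_colon R_char R_noeth _ _ _ tu);
      first exact: ideal_seq_ideal.
      exact: ideal_pow_ideal.
    move=> z sz; suff gen k : ideal_pow Q k.+1 (x ^+ k * z) by exact: gen.
    elim: k => [|k IH].
      by rewrite -[_ * z]mulrC; apply: ideal_powS => //; rewrite Q_def.
    by rewrite exprS -mulrA; apply: ideal_powS => //; rewrite Q_def;
      exact: ideal_seq_mem.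
  rewrite /= rmorphM rmorphXn -addn1 /P => Pxu;
    apply: (@power_modS_sub _ _ _ 0) => //.
  have rs := regS s szs ps; rewrite sE /= in Pxu rs *.
  exact: power_mod_colonX Pxu.
move=> h I [htI [ys szy Iys]]; apply/seteqP; split; rewrite {}Iys in htI *.
  exact: (tight_closure_mem R_char R_noeth (ideal_seq_ideal ys)).
have [le_hd dimI] := dim_le_height R_dim htI.
have [zs [szz mzs prz]] :=
  extend_to_primary R_noeth R_local (ideal_seq_ideal ys) dimI.
apply: (@tclosed_partial _ _ R_char R_noeth m d R_local regR ys zs).
- by rewrite szy szz subnKC.
- split=> [x|]; last by rewrite ideal_seqE adjoins_cat -ideal_seqE.
  rewrite mem_cat => /orP[ys_x|]; last exact: mzs.
  have [[I' [pI' ysI' _]] _] := htI.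
  by apply: (prime_sub_max R_noeth R_local pI'); apply: ysI';
    exact: ideal_seq_mem.
- move=> xs szx px.
  exact: (tclosed_params R_char R_noeth R_local regR szs szx ps px closedQ).
Qed.
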